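(* Let $\widetilde{W}$ be a rank 3 (irreducible) affine Weyl group, i.e. of type $\widetilde{A}_2$, $\widetilde{B}_2=\widetilde C_2$ or $\widetilde{G}_2$, with positive system $\widehat{\Phi}$. For any finite $R\subset\widehat{\Phi}$, the braid graph of $R$ is connected.
   Context: Affine setting: $\Phi$ is the irreducible crystallographic root system (finite and reduced, here of type $A_2$, $B_2$ or $G_2$) of a Weyl group, spanning a Euclidean space $V$ with inner product $(\cdot,\cdot)$, with a fixed positive system $\Phi^+$, simple system $\Pi$, $\Phi^-=-\Phi^+$. Let $V'=V\oplus\mathbb{R}\delta$, with the inner product extended by $(\delta,V')=0$. For $\alpha\in\Phi^+$ let $\widehat{\alpha}=\{\alpha+n\delta : n\in\mathbb{Z}_{\ge0}\}$; for $\alpha\in\Phi^-$ let $\widehat{\alpha}=\{\alpha+(n+1)\delta : n\in\mathbb{Z}_{\ge0}\}$; $\widehat{\Phi}=\bigcup_{\alpha\in\Phi}\widehat{\alpha}$. The affine Weyl group $\widetilde{W}$ is the Coxeter group generated by the reflections $s_\rho(v)=v-\frac{2(v,\rho)}{(\rho,\rho)}\rho$ of $V'$, $\rho\in\widehat\Phi$; its root system is $\widehat{\Phi}\cup-\widehat{\Phi}$, positive system $\widehat{\Phi}$, simple roots $\Pi\cup\{\delta-\gamma\}$ with $\gamma$ the highest root of $\Phi$. A reflection order on $\widehat\Phi$ is a total order $\prec$ such that whenever $\alpha\prec\beta$ in $\widehat\Phi$, $a,b\in\mathbb{R}_{>0}$ and $a\alpha+b\beta\in\widehat\Phi$, one has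 $\alpha\prec a\alpha+b\beta\prec\beta$. A reflection subgroup is a subgroup of $\widetilde W$ generated by reflections $s_\rho$; for a reflection subgroup $W'$ put $\Phi^+_{W'}=\{\rho\in\widehat\Phi : s_\rho\in W'\}$. A dihedral reflection subgroup is one generated by two distinct reflections; it is maximal if not properly contained in another dihedral reflection subgroup. Braid graph of a finite set $R\subset\widehat\Phi$: the vertices are the pairs $(R,\le)$ where $\le$ is a total order on $R$ obtained by restricting some reflection order of $\widehat\Phi$ to $R$ (different reflection orders with the same restriction to $R$ give the same vertex). If $(R,\le)$ is $\beta_1<\beta_2<\cdots<\beta_n$, a consecutive substring $\beta_{p+1}<\cdots<\beta_q$ is called a dihedral substring if there is a maximal dihedral reflection subgroup $W'$ with $R\cap\Phi^+_{W'}=\{\beta_{p+1},\dots,\beta_q\}$. Two vertices $(R,\le_1)$ and $(R,\le_2)$ are joined by an edge if and only if $(R,\le_2)$ is obtained by reversing a dihedral substring of $(R,\le_1)$. *)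

(* Defs.v *)
From HB Require Import structures.
From Stdlib Require Export Relation_Operators.
From mathcomp Require Export all_boot all_order all_algebra.
From mathcomp Require Export sesquilinear boolp classical_sets cardinality reals.

Set Implicit Arguments.
Unset Strict Implicit.
Unset Printing Implicit Defensive.

Import Order.TTheory GRing.Theory Num.Theory.
Local Open Scope classical_set_scope.
Local Open Scope ring_scope.

(* ** Finite root systems.  A Euclidean space is a finite-dimensional real
   vector space [V] with an inner product [ip : {dot V for idfun}], i.e. a
   positive definite symmetric bilinear form.  Finite sets of vectors of [V]
   are given by sequences, of which only the underlying set matters. *)

Definition refl (R : realType) (V : vectType R) (ip : {dot V for idfun})
    (a v : V) : V :=
  v - (2 * ip v a / ip a a) *: a.

Record root_system (R : realType) (V : vectType R) (ip : {dot V for idfun})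
    (Phi : seq V) : Prop := RootSystem {
  rs_neq0 : 0 \notin Phi;
  rs_span : <<Phi>>%VS = fullv;
  rs_refl : {in Phi &, forall a b, refl ip a b \in Phi};
  rs_reduced : {in Phi, forall a (c : R), c *: a \in Phi -> c = 1 \/ c = -1};
  rs_crystallographic :
    {in Phi &, forall a b, 2 * ip b a / ip a a \is a Num.int}
}.

(* [Phi] is nonempty and not the union of two nonempty, mutually orthogonal,
   disjoint subsets. *)
Definition irreducible_roots (R : realType) (V : vectType R)
    (ip : {dot V for idfun}) (Phi : seq V) : Prop :=
  [set` Phi] !=set0 /\
  forall A B : set V, A !=set0 -> B !=set0 -> A `&` B = set0 ->
    A `|` B = [set` Phi] -> exists a b, [/\ A a, B b & ip a b != 0].

Definition pos_root (R : realType) (V : vectType R) (Phi Pi : seq V) (a : V) :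
    Prop :=
  a \in Phi /\
  exists c : 'I_(size Pi) -> R,
    (forall i, 0 <= c i) /\ a = \sum_(i < size Pi) c i *: Pi`_i.

Definition simple_system (R : realType) (V : vectType R) (Phi Pi : seq V) :
    Prop :=
  [/\ {subset Pi <= Phi}, basis_of fullv Pi &
      {in Phi, forall a, pos_root Phi Pi a \/ pos_root Phi Pi (- a)}].

(* ** The affine root system.  The pair [(v, c)] stands for [v + c delta]. *)

Notation affine_space V R := (V * R^o)%type.

Definition aff_ip (R : realType) (V : vectType R) (ip : {dot V for idfun})
    (u v : affine_space V R) : R := ip u.1 v.1.

Definition aff_refl (R : realType) (V : vectType R) (ip : {dot V for idfun})
    (rho v : affine_space V R) : affine_space V R :=
  v - (2 * aff_ip ip v rho / aff_ip ip rho rho) *: rho.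

Definition aff_pos (R : realType) (V : vectType R) (Phi Pi : seq V) :
    set (affine_space V R) :=
  [set rho | exists (a : V) (n : nat), pos_root Phi Pi a /\ rho = (a, n%:R)]
  `|` [set rho | exists (a : V) (n : nat),
         pos_root Phi Pi (- a) /\ rho = (a, n.+1%:R)].

(* Only the restriction of [prec] to the affine positive roots matters. *)
Record reflection_order (R : realType) (V : vectType R) (Phi Pi : seq V)
    (prec : affine_space V R -> affine_space V R -> Prop) : Prop :=
  ReflectionOrder {
  ro_irr : forall x, aff_pos Phi Pi x -> ~ prec x x;
  ro_trans : forall x y z, aff_pos Phi Pi x -> aff_pos Phi Pi y ->
    aff_pos Phi Pi z -> prec x y -> prec y z -> prec x z;
  ro_total : forall x y, aff_pos Phi Pi x -> aff_pos Phi Pi y ->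
    x <> y -> prec x y \/ prec y x;
  ro_convex : forall x y (a b : R), aff_pos Phi Pi x -> aff_pos Phi Pi y ->
    prec x y -> 0 < a -> 0 < b -> aff_pos Phi Pi (a *: x + b *: y) ->
    prec x (a *: x + b *: y) /\ prec (a *: x + b *: y) y
}.

(* ** Reflection subgroups.  Elements of the affine Weyl group are
   transformations of [V + R delta]. *)

Definition transformation_group (T : Type) (W : set (T -> T)) : Prop :=
  [/\ W id,
      forall f g, W f -> W g -> W (f \o g) &
      forall f g, W f -> cancel f g -> cancel g f -> W g].

Definition generated_by (T : Type) (S : set (T -> T)) : set (T -> T) :=
  smallest (@transformation_group T) S.

Definition dihedral_subgroup (R : realType) (V : vectType R)
    (ip : {dot V for idfun}) (Phi Pi : seq V)
    (W : set (affine_space V R -> affine_space V R)) : Prop :=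
  exists r1 r2, [/\ aff_pos Phi Pi r1, aff_pos Phi Pi r2,
    aff_refl ip r1 <> aff_refl ip r2 &
    W = generated_by [set aff_refl ip r1; aff_refl ip r2]].

Definition maximal_dihedral (R : realType) (V : vectType R)
    (ip : {dot V for idfun}) (Phi Pi : seq V)
    (W : set (affine_space V R -> affine_space V R)) : Prop :=
  dihedral_subgroup ip Phi Pi W /\
  forall W', dihedral_subgroup ip Phi Pi W' -> ~ W `<` W'.

Definition subgroup_roots (R : realType) (V : vectType R)
    (ip : {dot V for idfun}) (Phi Pi : seq V)
    (W : set (affine_space V R -> affine_space V R)) :
    set (affine_space V R) :=
  [set rho | aff_pos Phi Pi rho /\ W (aff_refl ip rho)].

(* ** The braid graph.  A total order on a finite set [E] is encoded by the
   increasing enumeration of [E]; thus restrictions to [E] of two reflection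
   orders give the same sequence iff they are equal. *)

Definition braid_vertex (R : realType) (V : vectType R) (Phi Pi : seq V)
    (E : set (affine_space V R)) (s : seq (affine_space V R)) : Prop :=
  [/\ uniq s, [set` s] = E &
    exists2 prec, reflection_order Phi Pi prec &
      forall i j, (i < j < size s)%N -> prec s`_i s`_j].

Definition braid_edge (R : realType) (V : vectType R) (ip : {dot V for idfun})
    (Phi Pi : seq V) (E : set (affine_space V R))
    (s1 s2 : seq (affine_space V R)) : Prop :=
  [/\ braid_vertex Phi Pi E s1, braid_vertex Phi Pi E s2 &
    exists u t v, [/\ s1 = u ++ t ++ v, s2 = u ++ rev t ++ v &
      exists2 W, maximal_dihedral ip Phi Pi W &
        E `&` subgroup_roots ip Phi Pi W = [set` t]]].

(* Connectedness includes nonemptiness.  [braid_edge] is symmetric, so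
   undirected walks are directed ones. *)
Definition braid_graph_connected (R : realType) (V : vectType R)
    (ip : {dot V for idfun}) (Phi Pi : seq V) (E : set (affine_space V R)) :
    Prop :=
  (exists s, braid_vertex Phi Pi E s) /\
  forall s1 s2, braid_vertex Phi Pi E s1 -> braid_vertex Phi Pi E s2 ->
    clos_refl_trans _ (braid_edge ip Phi Pi E) s1 s2.

(* Main.v *)
From HB Require Import structures.
Require Import Defs.
From mathcomp Require Import ring lra zify.

Set Implicit Arguments.
Unset Strict Implicit.
Unset Printing Implicit Defensive.

Import Order.TTheory GRing.Theory Num.Theory.
Local Open Scope classical_set_scope.
Local Open Scope ring_scope.

(* A reflection order is a way of crossing, each exactly once, the hyperplanes
   of the positive roots while moving in the dual space from the chamber of a
   functional [f0] that is positive on all of them to the opposite chamber.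

   Given a reflection order with initial section B, the set P of roots made of
   the positive roots outside B and of the negatives of those in B is closed
   under positive combinations.  If delta lies on the positive side of P, no
   nonempty sum of elements of P vanishes, since two of the summands with
   negative inner product can be replaced by their sum, which is a root or a
   multiple of delta.  By Gordan's theorem every finite part of B is then
   contained in the negative set of a functional which is positive outside B;
   the other case is symmetric.  So on E every reflection order agrees with the order in which the
   roots are crossed along some polygonal path from [f0].

   Sliding the second node of such a path along the path, one straightens it:
   the order on E changes only when the first segment meets intersections of
   root hyperplanes, and there it changes by reversals of sets E n L where L is
   a plane, i.e., by braid moves.  In the end one gets the order by slopes g/f0
   for some functional g, and any two slope orders are connected by rotating g.
   All intermediate orders are reflection orders, whatever the way ties are
   broken. *)

(** The obstacle is that an initial section may be infinite with infinite complement, and then need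
    not be the negative set of any functional: the roots negative for some [v] in V, together with a
    finite part of a [delta]-string orthogonal to [v], can form such a section. Hence negativity is
    demanded on a finite part only, while positivity is demanded on the whole complement; this
    asymmetry makes it possible to nest the negative sets of consecutive nodes. The infinitely many
    positivity conditions reduce to finitely many because a functional positive on [delta] is
    controlled by the lowest root of each string. The replacement of summands works for sums with
    repetitions, so Gordan's theorem is needed with natural multiplicities; these exist because
    roots have integral Cartan pairings with the simple roots. That [delta] and [- delta] cannot
    both be positive combinations of P uses irreducibility and rank two of the finite system. The
    sign of [delta] changes at most once along an order, so a path consists of nodes positive on
    [delta] followed by nodes negative on it. *)

Section DotTheory.
Variables (R : realType) (U : lmodType R) (dot : {dot U for idfun}).

Lemma dotC u v : dot u v = dot v u.
Proof. by rewrite hermC /= expr0 mul1r. Qed.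

Lemma dotDl u v w : dot (u + v) w = dot u w + dot v w.
Proof. exact: linearDl. Qed.

Lemma dotZl a u w : dot (a *: u) w = a * dot u w.
Proof. exact: linearZl_LR. Qed.

Lemma dotDr u v w : dot w (u + v) = dot w u + dot w v.
Proof. by rewrite dotC dotDl dotC (dotC v). Qed.

Lemma dotZr a u w : dot w (a *: u) = a * dot w u.
Proof. by rewrite dotC dotZl dotC. Qed.

Lemma dotNl u w : dot (- u) w = - dot u w.
Proof. by rewrite -scaleN1r dotZl mulN1r. Qed.

Lemma dotNr u w : dot w (- u) = - dot w u.
Proof. by rewrite dotC dotNl dotC. Qed.

Lemma dotBl u v w : dot (u - v) w = dot u w - dot v w.
Proof. by rewrite dotDl dotNl. Qed.

Lemma dotBr u v w : dot w (u - v) = dot w u - dot w v.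
Proof. by rewrite dotDr dotNr. Qed.

Lemma dot0l w : dot 0 w = 0.
Proof. exact: linear0l. Qed.

Lemma dot0r w : dot w 0 = 0.
Proof. by rewrite dotC dot0l. Qed.

Lemma dot_gt0 u : u != 0 -> 0 < dot u u.
Proof. exact: neq0_dnorm_gt0. Qed.

Lemma dot_eq0 u : (dot u u == 0) = (u == 0).
Proof.
have [->|/dot_gt0] := eqVneq u 0; first by rewrite dot0l eqxx.
by rewrite lt0r => /andP[/negPf].
Qed.

Lemma dot_suml I (r : seq I) (P : pred I) (F : I -> U) w :
  dot (\sum_(i <- r | P i) F i) w = \sum_(i <- r | P i) dot (F i) w.
Proof. exact: linear_sumlz. Qed.

Definition dotE := (dotDl, dotDr, dotBl, dotBr, dotNl, dotNr, dotZl, dotZr).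

End DotTheory.

(** * Relative reflection orders and slopes *)

Section IntervalOrder.
Variables (R : realType) (M : lmodType R) (X : set M).
Implicit Types (A B C D : set M) (O : M -> M -> Prop).

Definition biconvex C := C `<=` X /\
  forall x y a b, X x -> X y -> 0 < a -> 0 < b -> X (a *: x + b *: y) ->
    (C x -> C y -> C (a *: x + b *: y)) /\
    (~ C x -> ~ C y -> ~ C (a *: x + b *: y)).

(* [O] orders [C `\` A] in the way some reflection order having [A] and [C] as
   initial sections could do: elements of [A] (resp. outside [C]) count as
   smaller (resp. larger) than those of [C `\` A]. *)
Record interval_order A C O : Prop := IntervalOrder {
  io_irr : forall x, C x -> ~ A x -> ~ O x x;
  io_trans : forall x y z, C x -> ~ A x -> C y -> ~ A y -> C z -> ~ A z ->
    O x y -> O y z -> O x z;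
  io_total : forall x y, C x -> ~ A x -> C y -> ~ A y -> x <> y ->
    O x y \/ O y x;
  io_in : forall x y a b, C x -> ~ A x -> C y -> ~ A y -> O x y ->
    0 < a -> 0 < b -> C (a *: x + b *: y) -> ~ A (a *: x + b *: y) ->
    O x (a *: x + b *: y) /\ O (a *: x + b *: y) y;
  io_hi : forall x y a b, C x -> ~ A x -> X y -> ~ C y ->
    0 < a -> 0 < b -> C (a *: x + b *: y) -> ~ A (a *: x + b *: y) ->
    O x (a *: x + b *: y);
  io_lo : forall x y a b, A x -> C y -> ~ A y ->
    0 < a -> 0 < b -> C (a *: x + b *: y) -> ~ A (a *: x + b *: y) ->
    O (a *: x + b *: y) y
}.

Definition total_interval_order := interval_order set0 X.

Definition glue C O O' x y : Prop :=
  C x /\ (C y -> O x y) \/ ~ C x /\ ~ C y /\ O' x y.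

(** If [x] lies in [C] and [y] does not, biconvexity does not decide where [a *: x + b *: y] falls.
    Inside [C] it follows [x] by [io_hi] of [O]; outside it precedes [y] by [io_lo] of [O']. These
    two clauses exist for this gluing. *)
Lemma interval_order_glue A C D O O' :
  biconvex C -> A `<=` C -> C `<=` D -> D `<=` X ->
  interval_order A C O -> interval_order C D O' ->
  interval_order A D (glue C O O').
Proof.
move=> [CX Cc] AC CD DX o o'.
have AD x : A x -> D x by move=> /AC/CD.
split.
- move=> x Dx nAx [[Cx] /(_ Cx)|[nCx [_]]].
  + exact: (io_irr o).
  + exact: (io_irr o').
- move=> x y z Dx Ax Dy Ay Dz Az [[Cx xy]|[nCx [nCy xy]]]
    [[Cy yz]|[nCy' [nCz yz]]] //.
  + left; split=> // Cz.
    by apply: (io_trans o _ _ Cy) => //; [exact: xy|exact: yz].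
  + by left; split.
  + by right; split=> //; split=> //; apply: (io_trans o' _ _ Dy).
- move=> x y Dx Ax Dy Ay xy.
  have [Cx|nCx] := pselect (C x); have [Cy|nCy] := pselect (C y).
  + by case: (io_total o Cx Ax Cy Ay xy) => h; [left|right]; left.
  + by left; left.
  + by right; left.
  + by case: (io_total o' Dx nCx Dy nCy xy) => h; [left|right]; right.
- move=> x y a b Dx Ax Dy Ay xy a0 b0 Dz Az.
  have Xx := DX _ Dx; have Xy := DX _ Dy; have Xz := DX _ Dz.
  have [cc nn] := Cc x y a b Xx Xy a0 b0 Xz.
  case: xy => [[Cx xy]|[nCx [nCy xy]]].
  + have [Cy|nCy] := pselect (C y).
      have Cz := cc Cx Cy.
      have [h1 h2] := io_in o Cx Ax Cy Ay (xy Cy) a0 b0 Cz Az.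
      by split; left.
    have [Cz|nCz] := pselect (C (a *: x + b *: y)).
      split; left; split=> // _.
      exact: (io_hi o Cx Ax Xy nCy a0 b0).
    split; first by left.
    by right; do 2 split=> //; apply: (io_lo o').
  + have nCz := nn nCx nCy.
    have [h1 h2] := io_in o' Dx nCx Dy nCy xy a0 b0 Dz nCz.
    by split; right.
- move=> x y a b Dx Ax Xy nDy a0 b0 Dz Az.
  have nCy : ~ C y by move/CD.
  have Xx := DX _ Dx; have Xz := DX _ Dz.
  have [cc nn] := Cc x y a b Xx Xy a0 b0 Xz.
  have [Cx|nCx] := pselect (C x).
    left; split=> // Cz; exact: (io_hi o).
  by right; split=> //; have nCz := nn nCx nCy; split=> //; apply: (io_hi o').
- move=> x y a b Ax Dy Ay a0 b0 Dz Az.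
  have Cx := AC _ Ax.
  have Xx := CX _ Cx; have Xz := DX _ Dz; have Xy := DX _ Dy.
  have [cc nn] := Cc x y a b Xx Xy a0 b0 Xz.
  have [Cz|nCz] := pselect (C (a *: x + b *: y)).
    by left; split=> // Cy; apply: (io_lo o).
  have nCy : ~ C y by move=> /(cc Cx).
  by right; do 2 split=> //; apply: (io_lo o').
Qed.

Lemma interval_order_refl A O : interval_order A A O.
Proof. by split. Qed.

Lemma total_interval_orderL C O : biconvex C -> total_interval_order O ->
  (forall x y, C x -> X y -> ~ C y -> O x y) -> interval_order set0 C O.
Proof.
move=> [CX _] o h; split=> //.
- by move=> x /CX Xx _; apply: (io_irr o).
- by move=> x y z /CX Xx _ /CX Xy _ /CX Xz _; apply: (io_trans o).
- by move=> x y /CX Xx _ /CX Xy _; apply: (io_total o).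
- by move=> x y a b /CX Xx _ /CX Xy _ xy a0 b0 /CX Xz _; apply: (io_in o).
- move=> x y a b Cx _ Xy nCy a0 b0 /CX Xz _.
  by have [] := io_in o (CX _ Cx) id Xy id (h _ _ Cx Xy nCy) a0 b0 Xz id.
Qed.

Lemma total_interval_orderR C O : biconvex C -> total_interval_order O ->
  (forall x y, C x -> X y -> ~ C y -> O x y) -> interval_order C X O.
Proof.
move=> [CX _] o h; split=> //.
- by move=> x Xx _; apply: (io_irr o).
- by move=> x y z Xx _ Xy _ Xz _; apply: (io_trans o).
- by move=> x y Xx _ Xy _; apply: (io_total o).
- by move=> x y a b Xx _ Xy _ xy a0 b0 Xz _; apply: (io_in o).
- move=> x y a b Cx Xy nCy a0 b0 Xz _.
  by have [] := io_in o (CX _ Cx) id Xy id (h _ _ Cx Xy nCy) a0 b0 Xz id.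
Qed.

End IntervalOrder.

Section Slopes.
Variables (R : realType) (M : lmodType R) (ev : {dot M for idfun}).
Variable X : set M.
Implicit Types (f g h k : M) (T : R -> M -> M -> Prop).

(** A functional moving straight from [f] to [k] and then on to [- f] meets the hyperplanes of the
    roots positive at [f] in order of increasing slope; the negative slopes are those met before
    [k]. *)
Definition slope f k x := ev k x / ev f x.

(** Ties are broken separately at each slope, so that one tie class at a time can be altered. *)
Definition slope_order f k T x y : Prop :=
  slope f k x < slope f k y \/
  slope f k x = slope f k y /\ T (slope f k x) x y.

Definition negset k : set M := [set x | X x /\ ev k x < 0].

(** Roots that vanish at [f] must be strictly negative at [g]; thus along the segment from [f] to
    [g] roots pass only from nonnegative to negative. *)
Definition above f g := forall x, X x -> ev f x <= 0 -> ev g x < 0.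

Lemma negset_sub k : negset k `<=` X.
Proof. by move=> x []. Qed.

Lemma negset_biconvex k : biconvex X (negset k).
Proof.
split; first exact: negset_sub.
move=> x y a b Xx Xy a0 b0 Xz; split.
  by move=> [_ kx] [_ ky]; split=> //; rewrite !dotE; nra.
move=> nx ny [_].
have kx : 0 <= ev k x by rewrite leNgt; apply/negP => kx; apply: nx.
have ky : 0 <= ev k y by rewrite leNgt; apply/negP => ky; apply: ny.
by rewrite ltNge !dotE; apply/negP; rewrite negbK; nra.
Qed.

Lemma not_negset k x : X x -> ~ negset k x -> 0 <= ev k x.
Proof. by move=> Xx nx; rewrite leNgt; apply/negP => kx; apply: nx. Qed.

Lemma slope_lt f k x y : 0 < ev f x -> 0 < ev f y ->
  (slope f k x < slope f k y) = (ev k x * ev f y < ev k y * ev f x).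
Proof.
by move=> fx fy; rewrite /slope ltr_pdivrMr// mulrAC ltr_pdivlMr.
Qed.

Lemma slope_eq f k x y : 0 < ev f x -> 0 < ev f y ->
  slope f k x = slope f k y -> ev k x * ev f y = ev k y * ev f x.
Proof.
move=> fx fy; rewrite /slope => e.
have fx0 : ev f x != 0 by rewrite gt_eqF.
have fy0 : ev f y != 0 by rewrite gt_eqF.
by rewrite -(divfK fx0 (ev k x)) e -mulrA (mulrC (ev f x)) mulrA divfK.
Qed.

Lemma slope_neg f k x : 0 < ev f x -> (slope f k x < 0) = (ev k x < 0).
Proof. by move=> fx; rewrite /slope pmulr_llt0// invr_gt0. Qed.

Lemma slope_order_in f k T x y a b :
  (forall c, total_interval_order X (T c)) ->
  X x -> X y -> X (a *: x + b *: y) ->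
  0 < ev f x -> 0 < ev f y -> 0 < a -> 0 < b ->
  slope_order f k T x y ->
  slope_order f k T x (a *: x + b *: y) /\
  slope_order f k T (a *: x + b *: y) y.
Proof.
move=> oT Xx Xy Xz fx fy a0 b0.
have fz : 0 < ev f (a *: x + b *: y) by rewrite !dotE; nra.
case=> [xy|[exy Txy]].
  rewrite slope_lt// in xy.
  split; left; rewrite slope_lt// !dotE; nra.
have e := slope_eq fx fy exy.
have exz : slope f k x = slope f k (a *: x + b *: y).
  have fx0 : ev f x != 0 by rewrite gt_eqF.
  have fz0 : ev f (a *: x + b *: y) != 0 by rewrite gt_eqF.
  apply/eqP; rewrite /slope eqr_div //; apply/eqP.
  by rewrite !dotE mulrDr mulrDl (mulrCA _ b) e; ring.
have [h1 h2] := io_in (oT (slope f k x)) Xx id Xy id Txy a0 b0 Xz id.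
by split; right; split=> //; rewrite -?exz.
Qed.

Lemma slope_order_irr f k T x : (forall c, total_interval_order X (T c)) ->
  X x -> ~ slope_order f k T x x.
Proof.
move=> oT Xx [|[_]]; first by rewrite ltxx.
exact: (io_irr (oT _)).
Qed.

Lemma slope_order_trans f k T x y z : (forall c, total_interval_order X (T c)) ->
  X x -> X y -> X z -> slope_order f k T x y -> slope_order f k T y z ->
  slope_order f k T x z.
Proof.
move=> oT Xx Xy Xz [xy|[exy xy]] [yz|[eyz yz]].
- by left; exact: lt_trans yz.
- by left; rewrite -eyz.
- by left; rewrite exy.
- right; split; first by rewrite exy.
  by apply: (io_trans (oT _) Xx id Xy id Xz id xy); rewrite exy.
Qed.

Lemma slope_order_total f k T x y : (forall c, total_interval_order X (T c)) ->
  X x -> X y -> x <> y -> slope_order f k T x y \/ slope_order f k T y x.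
Proof.
move=> oT Xx Xy xy.
case: (ltgtP (slope f k x) (slope f k y)) => e; [by left; left|by right; left|].
by case: (io_total (oT (slope f k x)) Xx id Xy id xy) => h; [left|right];
  right; split=> //; rewrite -e.
Qed.

Lemma slope_total_interval_order f k T : (forall x, X x -> 0 < ev f x) ->
  (forall c, total_interval_order X (T c)) ->
  total_interval_order X (slope_order f k T).
Proof.
move=> f0 oT; split=> //.
- by move=> x Xx _; apply: slope_order_irr.
- by move=> x y z Xx _ Xy _ Xz _; apply: slope_order_trans.
- by move=> x y Xx _ Xy _; apply: slope_order_total.
- by move=> x y a b Xx _ Xy _ xy a0 b0 Xz _; apply: slope_order_in => //;
  apply: f0.
Qed.

Lemma slope_order_init f k T x y : (forall x, X x -> 0 < ev f x) ->
  negset k x -> X y -> ~ negset k y -> slope_order f k T x y.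
Proof.
move=> f0 [Xx kx] Xy /(not_negset Xy) ky; left.
apply: (@lt_le_trans _ _ 0); first by rewrite slope_neg// f0.
by rewrite leNgt slope_neg -?leNgt// f0.
Qed.

(** [ev g x / - ev h x] is the ratio t / (1 - t) for the point [(1 - t) *: g + t *: h] at which [x]
    vanishes, so it grows with the crossing time. Roots nonnegative at [h] are positive at [g] by
    [above], which yields [io_hi] and [io_lo]. *)
Lemma segment_interval_order g h T : above g h ->
  (forall c, total_interval_order X (T c)) ->
  interval_order X (negset g) (negset h) (slope_order (- h) g T).
Proof.
move=> gh oT; split.
- by move=> x [Xx _] _; apply: slope_order_irr.
- by move=> x y z [Xx _] _ [Xy _] _ [Xz _] _; apply: slope_order_trans.
- by move=> x y [Xx _] _ [Xy _] _; apply: slope_order_total.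
- move=> x y a b [Xx hx] _ [Xy hy] _ xy a0 b0 [Xz _] _.
  by apply: slope_order_in => //; rewrite dotNl oppr_gt0.
- move=> x y a b [Xx hx] ngx Xy nhy a0 b0 [Xz hz] ngz.
  have gx := not_negset Xx ngx; have hy := not_negset Xy nhy.
  have gy : 0 < ev g y by rewrite ltNge; apply/negP => /(gh _ Xy); lra.
  left; rewrite slope_lt ?dotNl ?oppr_gt0//.
  have p1 : 0 < b * (ev g y * - ev h x) by rewrite !mulr_gt0// oppr_gt0.
  have p2 : 0 <= b * (ev g x * ev h y) by rewrite !mulr_ge0// ltW.
  by rewrite !dotE; lra.
- move=> x y a b [Xx gx] [Xy hy] ngy a0 b0 [Xz hz] ngz.
  have gy := not_negset Xy ngy.
  have hx : ev h x < 0 by apply: gh => //; apply: ltW.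
  left; rewrite slope_lt ?dotNl ?oppr_gt0//.
  have p1 : 0 < a * (ev g x * ev h y) by rewrite mulr_gt0// nmulr_rgt0.
  have p2 : 0 <= a * (ev g y * - ev h x).
    by rewrite !mulr_ge0 ?oppr_ge0// ltW.
  by rewrite !dotE; lra.
Qed.

End Slopes.

(** * Rank three *)

Section Rank3.
Variables (R : realType) (M : vectType R) (ev : {dot M for idfun}).
Hypothesis dimM : \dim {: M} = 3%N.

Lemma exists_orth (x y : M) : exists2 p, p != 0 & ev p x = 0 /\ ev p y = 0.
Proof.
have d1 := leq_dim_orthov1 ev x {: M}.
have d2 := leq_dim_orthov1 ev y ({: M} :&: orthov ev <[x]>)%VS.
set U := ({: M} :&: orthov ev <[x]> :&: orthov ev <[y]>)%VS in d2.
have U0 : U != 0%VS.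
  by rewrite -dimv_eq0 -lt0n; apply: leq_trans d2; rewrite -ltnS prednK//;
    move: d1; rewrite dimM; case: (\dim _) => //.
exists (vpick U); first by rewrite vpick0.
have := memv_pick U; rewrite !memv_cap !mem_orthov1.
by move=> /andP[/andP[_ /eqP ->] /eqP ->].
Qed.

Lemma orth_span (p x y z : M) : p != 0 -> free [:: x; y] ->
  ev p x = 0 -> ev p y = 0 -> ev p z = 0 -> exists a b, z = a *: x + b *: y.
Proof.
move=> p0 fxy px py pz.
have pp := dot_gt0 ev p0.
have pN : p \notin <<[:: x; y]>>%VS.
  apply/negP; rewrite span_cons span_seq1 => /memv_addP[u /vlineP[a ->]].
  move=> [v /vlineP[b ->] e]; move: pp.
  by rewrite {1}e !dotE (dotC ev x) (dotC ev y) px py !mulr0 addr0 ltxx.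
have fr : free [:: p; x; y] by rewrite free_cons pN.
have bs : basis_of fullv [:: p; x; y] by rewrite basisEfree fr subvf dimM.
have : z \in <<[:: p; x; y]>>%VS by rewrite (span_basis bs) memvf.
rewrite 2!span_cons span_seq1.
move=> /memv_addP[u /vlineP[c ->]] [w].
move=> /memv_addP[u' /vlineP[a ->]] [w' /vlineP[b ->] ->] e.
exists a, b; rewrite e; move: pz.
rewrite e !dotE px py !mulr0 !addr0 => /eqP; rewrite mulf_eq0 (gt_eqF pp) orbF.
by move=> /eqP ->; rewrite scale0r add0r.
Qed.

Variable X : set M.
Variable f0 : M.
Hypothesis f0X : forall x, X x -> 0 < ev f0 x.
Hypothesis Xred : forall x y c, X x -> X y -> y = c *: x -> y = x.
Notation total_order := (total_interval_order X).

Lemma free_roots x y : X x -> X y -> x != y -> free [:: x; y].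
Proof.
move=> Xx Xy xy; rewrite free_cons span_seq1 seq1_free; apply/andP; split.
  by apply: contra xy => /vlineP[c] /(Xred Xy Xx) ->.
by apply/eqP => y0; have := f0X Xy; rewrite y0 dot0r ltxx.
Qed.

(** As [f0] is positive on roots, the linear relation between the three cannot have all its
    coefficients of one sign; it is solved for the root whose sign is isolated. *)
Lemma root_between p x y z : p != 0 -> X x -> X y -> X z ->
  ev p x = 0 -> ev p y = 0 -> ev p z = 0 -> x != y -> x != z -> y != z ->
  exists a b, [/\ 0 < a, 0 < b & [\/ z = a *: x + b *: y,
    x = a *: y + b *: z | y = a *: x + b *: z]].
Proof.
move=> p0 Xx Xy Xz px py pz xy xz yz.
have [a [b e]] := orth_span p0 (free_roots Xx Xy xy) px py pz.
have := f0X Xx; have := f0X Xy; have := f0X Xz; rewrite {1}e !dotE => fz fy fx.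
have a0 : a != 0.
  apply: contra yz => /eqP a0; rewrite eq_sym; apply/eqP/(@Xred y z b) => //.
  by rewrite e a0 scale0r add0r.
have b0 : b != 0.
  apply: contra xz => /eqP b0; rewrite eq_sym; apply/eqP/(@Xred x z a) => //.
  by rewrite e b0 scale0r addr0.
case: (ltgtP 0 a) => [ap|an|]; last by move=> h; rewrite h eqxx in a0.
- case: (ltgtP 0 b) => [bp|bn|]; last by move=> h; rewrite h eqxx in b0.
  + by exists a, b; split=> //; constructor.
  + exists (- a^-1 * b), a^-1; split; rewrite ?invr_gt0//.
      by rewrite mulNr oppr_gt0 pmulr_rlt0// invr_gt0.
    constructor 2; rewrite e scalerDr !scalerA mulVf// scale1r addrCA.
    by rewrite -scalerDl mulNr addNr scale0r addr0.
- case: (ltgtP 0 b) => [bp|bn|]; last by move=> h; rewrite h eqxx in b0.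
  + exists (- b^-1 * a), b^-1; split; rewrite ?invr_gt0//.
      by rewrite mulNr oppr_gt0 pmulr_rlt0// invr_gt0.
    constructor 3; rewrite e scalerDr !scalerA mulVf// scale1r addrA.
    by rewrite -scalerDl mulNr addNr scale0r add0r.
  + by exfalso; nra.
Qed.

(** Since [x] precedes both others under [O], it is not the middle one of the three. Whichever of
    [y] and [z] is in the middle, [O' x y] then forces [O' x z]. *)
Lemma order_step O O' p x y z : total_order O -> total_order O' -> p != 0 ->
  X x -> X y -> X z -> ev p x = 0 -> ev p y = 0 -> ev p z = 0 ->
  x != y -> x != z -> O x y -> O' x y -> O x z -> O' x z.
Proof.
move=> o o' p0 Xx Xy Xz px py pz xy xz Oxy O'xy Oxz.
have [<-//|yz] := eqVneq y z.
have [a [b [a0 b0 e]]] := root_between p0 Xx Xy Xz px py pz xy xz yz.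
have ex u v : a *: u + b *: v = b *: v + a *: u by rewrite addrC.
case: e => e.
- by move: Xz; rewrite e => Xz; have [] := io_in o' Xx id Xy id O'xy a0 b0 Xz id.
- have [//|zx] : O' x z \/ O' z x by apply: (io_total o') => //; apply/eqP.
  have zny : y <> z by apply/eqP.
  exfalso; have [yz'|zy'] := io_total o Xy id Xz id zny.
    have := io_in o Xy id Xz id yz' a0 b0; rewrite -e => /(_ Xx id)[yx _].
    exact: (io_irr o Xx id (io_trans o Xx id Xy id Xx id Oxy yx)).
  have := io_in o Xz id Xy id zy' b0 a0; rewrite -ex -e => /(_ Xx id)[zx' _].
  exact: (io_irr o Xx id (io_trans o Xx id Xz id Xx id Oxz zx')).
- have [//|zx] : O' x z \/ O' z x by apply: (io_total o') => //; apply/eqP.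
  have := io_in o' Xz id Xx id zx b0 a0; rewrite -ex -e => /(_ Xy id)[_ yx].
  by exfalso; apply: (io_irr o' Xx id (io_trans o' Xx id Xy id Xx id O'xy yx)).
Qed.

Lemma total_order_rev O : total_order O -> total_order (fun x y => O y x).
Proof.
move=> o; split=> //.
- exact: (io_irr o).
- by move=> x y z Xx _ Xy _ Xz _ yx zy; apply: (io_trans o Xz id Xy id Xx id).
- by move=> x y Xx _ Xy _ /(io_total o Xx id Xy id)[]; [right|left].
- move=> x y a b Xx _ Xy _ yx a0 b0 Xz _.
  rewrite addrC in Xz *.
  by have [] := io_in o Xy id Xx id yx b0 a0 Xz id.
Qed.

Lemma order_same O O' p x y z w : total_order O -> total_order O' -> p != 0 ->
  X x -> X y -> X z -> X w -> ev p x = 0 -> ev p y = 0 -> ev p z = 0 ->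
  ev p w = 0 -> x != y -> O x y -> O' x y -> z != w -> O z w -> O' z w.
Proof.
have step O1 O2 := @order_step O1 O2 p.
move=> o o' p0 Xx Xy Xz Xw px py pz pw xy Oxy O'xy zw Ozw.
have r := total_order_rev o; have r' := total_order_rev o'.
have tot u v : X u -> X v -> u != v -> O u v \/ O v u.
  by move=> Xu Xv uv; apply: (io_total o) => //; apply/eqP.
have [xz|xz] := eqVneq x z.
  by subst z; apply: (step _ _ x y w o o' p0).
(* Transfer the agreement of [O] and [O'] on [x, y] to [x, z], then to [z, w]. *)
case: (tot x z Xx Xz xz) => [Oxz|Ozx].
  have O'xz : O' x z by apply: (step _ _ x y z o o' p0).
  have [//|O'wz] := io_total o' Xz id Xw id (elimN eqP zw).
  have zx : z != x by rewrite eq_sym.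
  have [xw|xw] := eqVneq x w.
    by subst w; case: (io_irr o Xx id (io_trans o Xx id Xz id Xx id Oxz Ozw)).
  have Oxw := io_trans o Xx id Xz id Xw id Oxz Ozw.
  have wz : w != z by rewrite eq_sym.
  have wx : w != x by rewrite eq_sym.
  have O'xw : O' x w by apply: (step _ _ x z w o o' p0).
  exact: (step _ _ w x z r r' p0).
have nO'xz : ~ O' x z.
  move=> O'xz; have : O x z.
    by apply: (step _ _ x y z o' o p0).
  by move=> Oxz; apply: (io_irr o Xx id (io_trans o Xx id Xz id Xx id Oxz Ozx)).
have zx : z != x by rewrite eq_sym.
have [//|O'zx] := io_total o' Xx id Xz id (elimN eqP xz).
by apply: (step _ _ z x w o o' p0).
Qed.

(** One agreeing pair decides the whole plane by [order_same]; if there is none, every pair is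
    reversed. *)
Lemma order_same_or_opposite O O' p (c : {pred M}) : total_order O ->
  total_order O' -> p != 0 ->
  (forall x, x \in c -> X x /\ ev p x = 0) ->
  {in c &, forall x y, x != y -> (O x y <-> O' x y)} \/
  {in c &, forall x y, x != y -> (O x y <-> O' y x)}.
Proof.
move=> o o' p0 cX.
have r' := total_order_rev o'.
have [[x [y [xc yc xy Oxy O'xy]]]|nE] :=
  pselect (exists x y, [/\ x \in c, y \in c, x != y, O x y & O' x y]).
  left=> z w zc wc zw.
  have [Xx px] := cX _ xc; have [Xy py] := cX _ yc.
  have [Xz pz] := cX _ zc; have [Xw pw] := cX _ wc.
  split; first exact: (@order_same _ _ p x y).
  exact: (@order_same _ _ p x y).
right=> z w zc wc zw.
have [Xz pz] := cX _ zc; have [Xw pw] := cX _ wc.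
split=> [Ozw|O'wz].
  have [O'zw|//] := io_total o' Xz id Xw id (elimN eqP zw).
  by case: nE; exists z, w.
have [//|Owz] := io_total o Xz id Xw id (elimN eqP zw).
by case: nE; exists w, z; split=> //; rewrite eq_sym.
Qed.

(** Slopes along [k] and [l] are compared lexicographically. As [f0], [k], [l] are orthogonal and
    span, roots with both slopes equal are proportional. *)
Lemma exists_total_order : exists O, total_order O.
Proof.
have [f00|f0n] := eqVneq f0 0.
  have X0 x : ~ X x by move=> /f0X; rewrite f00 dot0l ltxx.
  by exists (fun _ _ => False); split=> // x y Xx; case: (X0 x).
have [k k0 [kf _]] := exists_orth f0 f0.
have [l l0 [lf lk]] := exists_orth f0 k.
have eqX x y : X x -> X y -> slope ev f0 k x = slope ev f0 k y ->
    slope ev f0 l x = slope ev f0 l y -> y = x.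
  move=> Xx Xy; have fx := f0X Xx; have fy := f0X Xy.
  move=> /(slope_eq fx fy) ek /(slope_eq fx fy) el.
  pose w := ev f0 y *: x - ev f0 x *: y.
  have fkl : free [:: k; l].
    rewrite free_cons span_seq1 seq1_free l0 andbT; apply: contra k0.
    move=> /vlineP[c kc]; move: lk; rewrite kc dotZr => /eqP.
    by rewrite mulf_eq0 dot_eq0 (negPf l0) orbF => /eqP ->; rewrite scale0r.
  have fk : ev f0 k = 0 by rewrite dotC.
  have fl : ev f0 l = 0 by rewrite dotC.
  have fw : ev f0 w = 0 by rewrite /w !dotE mulrC subrr.
  have kw : ev k w = 0 by rewrite /w !dotE mulrC ek mulrC subrr.
  have lw : ev l w = 0 by rewrite /w !dotE mulrC el mulrC subrr.
  have [a [b e]] := orth_span f0n fkl fk fl fw.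
  have a0 : a = 0.
    move: kw; rewrite e !dotE (dotC ev k l) lk mulr0 addr0 => /eqP.
    by rewrite mulf_eq0 dot_eq0 (negPf k0) orbF => /eqP.
  have b0 : b = 0.
    move: lw; rewrite e !dotE lk mulr0 add0r => /eqP.
    by rewrite mulf_eq0 dot_eq0 (negPf l0) orbF => /eqP.
  have xy : ev f0 y *: x = ev f0 x *: y.
    by apply/eqP; rewrite -subr_eq0 -/w e a0 b0 !scale0r addr0.
  apply: (Xred Xx Xy (c := (ev f0 x)^-1 * ev f0 y)).
  by rewrite -scalerA xy scalerA mulVf ?scale1r// gt_eqF.
have mid g x y a b : X x -> X y -> X (a *: x + b *: y) -> 0 < a -> 0 < b ->
    (slope ev f0 g x < slope ev f0 g y ->
       slope ev f0 g x < slope ev f0 g (a *: x + b *: y) /\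
       slope ev f0 g (a *: x + b *: y) < slope ev f0 g y) /\
    (slope ev f0 g x = slope ev f0 g y ->
       slope ev f0 g (a *: x + b *: y) = slope ev f0 g x).
  move=> Xx Xy Xz a0 b0; have fx := f0X Xx; have fy := f0X Xy; have fz := f0X Xz.
  split; first by rewrite !slope_lt// !dotE => h; split; nra.
  move=> /(slope_eq fx fy) e; apply/eqP; rewrite /slope eqr_div ?lt0r_neq0//.
  by apply/eqP; rewrite !dotE mulrDl mulrDr -!mulrA -e; ring.
exists (fun x y => slope ev f0 k x < slope ev f0 k y \/
  slope ev f0 k x = slope ev f0 k y /\ slope ev f0 l x < slope ev f0 l y).
split=> //.
- by move=> x _ _ [|[_]]; rewrite ltxx.
- move=> x y z _ _ _ _ _ _ [xy|[exy xy]] [yz|[eyz yz]].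
  + by left; exact: lt_trans yz.
  + by left; rewrite -eyz.
  + by left; rewrite exy.
  + by right; rewrite exy; split=> //; exact: lt_trans yz.
- move=> x y Xx _ Xy _ xy.
  have [h|h|h] := ltgtP (slope ev f0 k x) (slope ev f0 k y); [by left; left|by right; left|].
  have [h'|h'|h'] := ltgtP (slope ev f0 l x) (slope ev f0 l y).
  + by left; right.
  + by right; right.
  + by case: xy; rewrite (eqX x y).
- move=> x y a b Xx _ Xy _ xy a0 b0 Xz _.
  have [mk ek] := mid k _ _ _ _ Xx Xy Xz a0 b0.
  have [ml _] := mid l _ _ _ _ Xx Xy Xz a0 b0.
  case: xy => [/mk[h1 h2]|[exy /ml[h1 h2]]]; first by split; left.
  by rewrite (ek exy); split; right.
Qed.

Lemma total_order_min O (s : seq M) : total_order O -> s != [::] ->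
  (forall x, x \in s -> X x) ->
  exists2 a, a \in s & forall z, z \in s -> z != a -> O a z.
Proof.
move=> o; elim: s => [//|x s IHs] _ sX.
have Xx : X x by apply: sX; rewrite inE eqxx.
have sX' z : z \in s -> X z by move=> zs; apply: sX; rewrite inE zs orbT.
have [->|/IHs/(_ sX')[a as_ amin]] := eqVneq s [::].
  by exists x; rewrite ?inE// => z; rewrite inE => /eqP ->; rewrite eqxx.
have Xa := sX' _ as_.
have [xa|/eqP xa] := eqVneq x a.
  exists a; first by rewrite inE as_ orbT.
  by move=> z; rewrite inE xa => /orP[/eqP ->|]; [rewrite eqxx|exact: amin].
case: (io_total o Xx id Xa id xa) => h; last first.
  exists a; first by rewrite inE as_ orbT.
  by move=> z; rewrite inE => /orP[/eqP ->//|]; exact: amin.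
exists x; first by rewrite inE eqxx.
move=> z; rewrite inE => /orP[/eqP ->|zs _]; first by rewrite eqxx.
have [->//|za] := eqVneq z a.
by apply: (io_trans o Xx id Xa id (sX' _ zs) id h); exact: amin.
Qed.

Lemma min_not_between O a b c (s t : R) : total_order O -> X a -> X b -> X c ->
  O a b -> O a c -> 0 < s -> 0 < t -> b != c -> a <> s *: b + t *: c.
Proof.
move=> o Xa Xb Xc ab ac s0 t0 /eqP bc e.
case: (io_total o Xb id Xc id bc) => h.
  have := io_in o Xb id Xc id h s0 t0; rewrite -e => /(_ Xa id)[ba _].
  exact: (io_irr o Xa id (io_trans o Xa id Xb id Xa id ab ba)).
rewrite addrC in e.
have := io_in o Xc id Xb id h t0 s0; rewrite -e => /(_ Xa id)[ca _].
exact: (io_irr o Xa id (io_trans o Xa id Xc id Xa id ac ca)).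
Qed.

(** The least and the greatest root of [s] for some reflection order are never between two others,
    so [root_between] puts every other root of [s] between them. *)
Lemma extreme_roots p (s : seq M) x y : p != 0 ->
  (forall z, z \in s -> X z /\ ev p z = 0) -> x \in s -> y \in s -> x != y ->
  exists a b, [/\ a \in s, b \in s, a != b &
    forall z, z \in s -> exists c d, [/\ 0 <= c, 0 <= d & z = c *: a + d *: b]].
Proof.
move=> p0 sX xs ys xy; have [O o] := exists_total_order.
have o' := total_order_rev o.
have s0 : s != [::] by case: (s) xs.
have sX' z : z \in s -> X z by move/sX=> [].
have [a as_ amin] := total_order_min o s0 sX'.
have [b bs bmax] := total_order_min o' s0 sX'.
have [Xa pa] := sX _ as_; have [Xb pb] := sX _ bs.
have ab : a != b.
  apply/eqP => ab; subst b.
  have [w ws wa] : exists2 w, w \in s & w != a.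
    have [xa|xa] := eqVneq x a; last by exists x.
    by exists y => //; rewrite -xa eq_sym.
  have Xw := sX' _ ws.
  apply: (io_irr o Xa id (io_trans o Xa id Xw id Xa id _ _)).
    exact: amin.
  exact: bmax.
exists a, b; split=> // z zs; have [Xz pz] := sX _ zs.
have [->|az] := eqVneq z a.
  by exists 1, 0; rewrite ler01 lexx scale1r scale0r addr0.
have [->|bz] := eqVneq z b.
  by exists 0, 1; rewrite ler01 lexx scale1r scale0r add0r.
have az' : a != z by rewrite eq_sym.
have bz' : b != z by rewrite eq_sym.
have ba : b != a by rewrite eq_sym.
have [c [d [c0 d0 e]]] := root_between p0 Xa Xb Xz pa pb pz ab az' bz'.
case: e => e.
- by exists c, d; split=> //; exact: ltW.
- by case: (min_not_between o Xa Xb Xz (amin _ bs ba) (amin _ zs az) c0 d0 bz' e).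
- by case: (min_not_between o' Xb Xa Xz (bmax _ as_ ab) (bmax _ zs bz) c0 d0 az' e).
Qed.

End Rank3.

Lemma pairwise_perm_eq (T : eqType) (r : rel T) (s t : seq T) :
  {in s &, antisymmetric r} -> pairwise r s -> pairwise r t -> perm_eq s t ->
  s = t.
Proof.
elim: s t => [|x s IHs] [|y t] asym //=; try by move=> _ _ /perm_size.
move=> /andP[xs ps] /andP[yt pt] st.
have xy : x = y.
  apply/eqP; apply: contraT => xy.
  have xt : x \in t.
    by have := perm_mem st x; rewrite !inE eqxx (negPf xy) /= => <-.
  have ys : y \in s.
    by have := perm_mem st y; rewrite !inE eqxx eq_sym (negPf xy) /=.
  have rxy := allP xs _ ys; have ryx := allP yt _ xt.
  have e : x = y by apply: asym; rewrite ?inE ?ys ?eqxx ?orbT// rxy.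
  by rewrite e eqxx in xy.
subst y; congr cons; apply: IHs => //; last by rewrite perm_cons in st.
by move=> u v us vs; apply: asym; rewrite inE ?us ?vs orbT.
Qed.

Lemma count_sub_lt (T : eqType) (a b : pred T) (s : seq T) z :
  subpred a b -> z \in s -> ~~ a z -> b z -> (count a s < count b s)%N.
Proof.
move=> ab + az bz; elim: s => [//|x s IHs] /=; rewrite inE.
move=> /orP[/eqP <-|/IHs h].
  by rewrite (negPf az) bz add0n add1n ltnS; exact: sub_count.
by rewrite -addnS leq_add//; case: (boolP (a x)) => // /ab ->.
Qed.

(** * Enumerations of a finite set of roots and reversals along planes *)

Section Lists.
Variables (R : realType) (M : vectType R) (ev : {dot M for idfun}).
Hypothesis dimM : \dim {: M} = 3%N.
Variable X : set M.
Variable f0 : M.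
Hypothesis f0X : forall x, X x -> 0 < ev f0 x.
Hypothesis Xred : forall x y c, X x -> X y -> y = c *: x -> y = x.
Notation total_order := (total_interval_order X).
Variable E : seq M.
Hypothesis uniqE : uniq E.
Hypothesis EX : forall x, x \in E -> X x.
Implicit Types (O : M -> M -> Prop).

Definition agree O O' := {in E &, forall x y, O x y <-> O' x y}.

(** Intermediate orders such as [tie_order] are controlled only on [E]; they need not be reflection
    orders on all of [X]. *)
Definition extendable O := exists2 O', total_order O' & agree O O'.

Definition enumerates O s := perm_eq s E /\ pairwise (fun x y => `[< O x y >]) s.

Definition vertex s := exists2 O, total_order O & enumerates O s.

Lemma total_order_extendable O : total_order O -> extendable O.
Proof. by exists O. Qed.

Lemma agree_sym O O' : agree O O' -> agree O' O.
Proof. by move=> a x y xE yE; split=> /a; apply. Qed.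

Lemma agree_trans O O' O'' : agree O O' -> agree O' O'' -> agree O O''.
Proof.
by move=> a b x y xE yE; split=> [/(a _ _ xE yE)/b|/(b _ _ xE yE)/a]; apply.
Qed.

Lemma extendable_agree O O' : agree O O' -> extendable O -> extendable O'.
Proof. by move=> a [P oP b]; exists P => //; exact: agree_trans (agree_sym a) b. Qed.

Lemma extendable_irr O x : extendable O -> x \in E -> ~ O x x.
Proof. by move=> [P oP a] xE /a-/(_ xE xE); apply: (io_irr oP (EX xE)). Qed.

Lemma extendable_trans O x y z : extendable O -> x \in E -> y \in E -> z \in E ->
  O x y -> O y z -> O x z.
Proof.
move=> [P oP a] xE yE zE /a-/(_ xE yE) xy /a-/(_ yE zE) yz; apply/a => //.
by apply: (io_trans oP (EX xE) id (EX yE) id (EX zE)).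
Qed.

Lemma extendable_total O x y : extendable O -> x \in E -> y \in E -> x != y ->
  O x y \/ O y x.
Proof.
move=> [P oP a] xE yE /eqP xy.
by case: (io_total oP (EX xE) id (EX yE) id xy) => /a h; [left|right]; apply: h.
Qed.

Lemma enumerates_agree O O' s : agree O O' -> enumerates O s -> enumerates O' s.
Proof.
move=> a [sE ps]; split=> //; apply: (@sub_in_pairwise _ (mem E) _ _ _ _ _ ps).
  by move=> x y xE yE /asboolP /a h; apply/asboolP/h.
by apply/allP => x; rewrite (perm_mem sE).
Qed.

Lemma enumerates_uniq O s t : extendable O -> enumerates O s ->
  enumerates O t -> s = t.
Proof.
move=> rO [sE ps] [tE pt]; apply: (pairwise_perm_eq _ ps pt).
  move=> x y; rewrite !(perm_mem sE) => xE yE /andP[/asboolP xy /asboolP yx].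
  by case: (extendable_irr rO xE (extendable_trans rO xE yE xE xy yx)).
by rewrite (permPl sE) perm_sym.
Qed.

Lemma enumerates_exists O : extendable O -> exists s, enumerates O s.
Proof.
move=> rO; pose r x y := (x == y) || `[< O x y >].
exists (sort r E); split; first by rewrite perm_sort.
have allE : all (mem E) (sort r E) by apply/allP => x; rewrite mem_sort.
have : sorted r (sort r E).
  apply: (@sort_sorted_in _ (mem E)); last exact/allP.
  move=> x y xE yE; rewrite /r eq_sym; have [//|/= yx] := eqVneq y x.
  by case: (extendable_total rO yE xE yx) => h; apply/orP; [right|left]; apply/asboolP.
rewrite (@sorted_pairwise_in _ (mem E))//; last first.
  move=> y x z yE xE zE /orP[/eqP ->//|/asboolP xy] /orP[/eqP <-|/asboolP yz].
    by apply/orP; right; apply/asboolP.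
  by apply/orP; right; apply/asboolP; apply: (extendable_trans rO xE yE zE).
have : uniq (sort r E) by rewrite sort_uniq.
rewrite uniq_pairwise => pu pr.
have := pairwise_relI r (fun x y => x != y) (sort r E).
rewrite pr pu; apply: sub_pairwise => x y /= /andP[/orP[-> //|//]].
Qed.

Lemma enumerates_vertex O s : extendable O -> enumerates O s -> vertex s.
Proof. by move=> [P oP a] /(enumerates_agree a); exists P. Qed.

(* The planes [p = 0] play the role of the maximal dihedral subgroups, cf.
   [plane_maximal_dihedral] below. *)
Definition flip s s' := [/\ vertex s, vertex s' &
  exists u t v p, [/\ s = u ++ t ++ v, s' = u ++ rev t ++ v, p != 0,
    forall x, (x \in t) = (x \in E) && (ev p x == 0) & (1 < size t)%N]].

Definition connected s s' := clos_refl_trans _ flip s s'.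

Lemma flip_sym s s' : flip s s' -> flip s' s.
Proof.
move=> [vs vs' [u [t [v [p [es es' p0 tp st]]]]]]; split=> //.
exists u, (rev t), v, p; rewrite revK size_rev; split=> //.
by move=> x; rewrite mem_rev tp.
Qed.

Lemma connected_sym s s' : connected s s' -> connected s' s.
Proof.
elim=> [a b /flip_sym|a|a b c _ ba _ cb]; [exact: rt_step|exact: rt_refl|].
exact: rt_trans cb ba.
Qed.

(** Quantifying over enumerations avoids choosing one. The statement is vacuous when none exists,
    whence the [extendable] hypothesis on the middle order in transitivity. *)
Definition connected_orders O O' := forall s s',
  enumerates O s -> enumerates O' s' -> connected s s'.

Lemma connected_orders_sym O O' : connected_orders O O' -> connected_orders O' O.
Proof. by move=> c s s' es es'; apply/connected_sym/c. Qed.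

Lemma connected_orders_trans O O' O'' : extendable O' ->
  connected_orders O O' -> connected_orders O' O'' -> connected_orders O O''.
Proof.
move=> /enumerates_exists[t et] c c' s s' es es'.
by apply: rt_trans (c _ _ es et) (c' _ _ et es').
Qed.

Lemma connected_orders_agree O O' : extendable O -> agree O O' ->
  connected_orders O O'.
Proof.
move=> rO a s s' es /(enumerates_agree (agree_sym a)) es'.
by rewrite (enumerates_uniq rO es es'); exact: rt_refl.
Qed.

(** The last hypothesis says that no root off the plane separates two roots on it. The roots of [E]
    on the plane are therefore consecutive, and [x0] splits the others into those before and those
    after. *)
Lemma flip_plane O O' p x0 y0 : extendable O -> extendable O' -> p != 0 ->
  x0 \in E -> y0 \in E -> x0 != y0 -> ev p x0 = 0 -> ev p y0 = 0 ->
  (forall x y, x \in E -> y \in E -> ev p y != 0 ->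
    (O x y <-> O' x y) /\ (O y x <-> O' y x)) ->
  (forall x y, x \in E -> y \in E -> ev p x = 0 -> ev p y = 0 -> x != y ->
    (O x y <-> O' y x)) ->
  (forall x z y, x \in E -> y \in E -> z \in E -> ev p x = 0 -> ev p z = 0 ->
    ev p y != 0 -> (O x y -> O z y) /\ (O y x -> O y z)) ->
  connected_orders O O'.
Proof.
move=> rO rO' p0 x0E y0E xy0 px0 py0 same opp conv s s' es es'.
have [sE ps] := es; apply: rt_step; split.
- exact: enumerates_vertex es.
- exact: enumerates_vertex es'.
pose t := [seq x <- s | ev p x == 0].
pose u := [seq x <- s | (ev p x != 0) && `[< O x x0 >]].
pose v := [seq x <- s | (ev p x != 0) && `[< O x0 x >]].
have us : uniq s by rewrite (perm_uniq sE).
have tP x : (x \in t) = (x \in E) && (ev p x == 0).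
  by rewrite mem_filter (perm_mem sE) andbC.
have uP x : reflect [/\ x \in E, ev p x != 0 & O x x0] (x \in u).
  rewrite mem_filter (perm_mem sE); apply: (iffP andP).
    by move=> [/andP[px /asboolP h] xE].
  by move=> [xE px h]; split=> //; apply/andP; split=> //; apply/asboolP.
have vP x : reflect [/\ x \in E, ev p x != 0 & O x0 x] (x \in v).
  rewrite mem_filter (perm_mem sE); apply: (iffP andP).
    by move=> [/andP[px /asboolP h] xE].
  by move=> [xE px h]; split=> //; apply/andP; split=> //; apply/asboolP.
have utv : uniq (u ++ t ++ v).
  rewrite !cat_uniq !filter_uniq//= !andbT; apply/andP; split.
    rewrite has_cat negb_or; apply/andP; split; apply/hasPn => x.
      by rewrite tP => /andP[_ px]; apply/uP => -[_]; rewrite px.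
    move=> /vP[xE px x0x]; apply/uP => -[_ _ xx0].
    exact: extendable_irr rO xE (extendable_trans rO xE x0E xE xx0 x0x).
  apply/hasPn => x /vP[_ px _]; rewrite tP (negPf px) andbF//.
have mem_utv : u ++ t ++ v =i E.
  move=> x; rewrite !mem_cat tP; apply/idP/idP.
    by move=> /orP[/uP[]//|/orP[/andP[]//|/vP[]]].
  move=> xE; rewrite xE; have [px|px] := eqVneq (ev p x) 0; first by rewrite orbT.
  have xx0 : x != x0 by apply: contra px => /eqP ->; rewrite px0.
  case: (extendable_total rO xE x0E xx0) => h; apply/orP; [left|right].
    exact/uP.
  exact/vP.
have perm_utv : perm_eq (u ++ t ++ v) E by apply: uniq_perm.
have perm_utv' : perm_eq (u ++ rev t ++ v) E.
  by apply: perm_trans perm_utv; rewrite perm_cat2l perm_cat2r perm_rev.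
have ut x y : x \in u -> y \in t -> O x y.
  move=> /uP[xE px xx0]; rewrite tP => /andP[yE /eqP py].
  by have [_] := conv x0 y x x0E xE yE px0 py px; apply.
have tv x y : x \in t -> y \in v -> O x y.
  rewrite tP => /andP[xE /eqP px] /vP[yE py x0y].
  by have [+ _] := conv x0 x y x0E yE xE px0 px py; apply.
have uv x y : x \in u -> y \in v -> O x y.
  by move=> /uP[xE _ xx0] /vP[yE _ x0y]; apply: (extendable_trans rO xE x0E yE).
have es1 : enumerates O (u ++ t ++ v).
  split=> //; rewrite !pairwise_cat !pairwise_filter// !andbT /= allrel_catr.
  rewrite -andbA; apply/and3P; split; apply/allrelP => x y xu yv; apply/asboolP.
  - exact: ut.
  - exact: uv.
  - exact: tv.
have sub w : {subset w <= s} -> all (mem E) w.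
  by move=> ws; apply/allP => x /ws; rewrite (perm_mem sE).
have Ou x y : x \in E -> y \in E -> ev p y != 0 -> O x y -> O' x y.
  by move=> xE yE py; have [[]] := same x y xE yE py.
have Ov x y : x \in E -> y \in E -> ev p x != 0 -> O x y -> O' x y.
  by move=> xE yE py; have [_ []] := same y x yE xE py.
have es2 : enumerates O' (u ++ rev t ++ v).
  split=> //; rewrite !pairwise_cat allrel_catr.
  have pu w : {subset w <= E} -> all (fun x => ev p x != 0) w ->
      pairwise (fun x y => `[< O x y >]) w ->
      pairwise (fun x y => `[< O' x y >]) w.
    move=> wE /allP wp; apply: (@sub_in_pairwise _ (mem w)); last exact/allP.
    by move=> x y xw yw /asboolP h; apply/asboolP/Ou; rewrite ?wp ?wE.
  have pt : pairwise (fun x y => `[< O' x y >]) (rev t).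
    have : pairwise (fun x y => `[< O x y >]) t by rewrite pairwise_filter.
    have : {subset t <= t} by [].
    have : uniq t by rewrite filter_uniq.
    (* Only the list being reversed is generalised; membership in the original [t] is kept, since it
       places the roots on the plane. *)
    elim: {1 2 4 5} t => [//|x w IHw] /= /andP[xw uw] wt /andP[xpw pw].
    rewrite rev_cons -cats1 pairwise_cat IHw ?andbT//=; last first.
      by move=> y yw; apply: wt; rewrite inE yw orbT.
    apply/allrelP => y z; rewrite mem_rev inE => yw /eqP ->.
    have /asboolP xy := allP xpw _ yw.
    have := wt x; rewrite inE eqxx tP => /(_ isT)/andP[xE /eqP px].
    have := wt y; rewrite inE yw orbT tP => /(_ isT)/andP[yE /eqP py].
    have nxy : x != y by apply: contra xw => /eqP ->.
    by apply/asboolP; have [h _] := opp x y xE yE px py nxy; apply: h.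
  rewrite pt !pu ?pairwise_filter ?andbT//; last 4 first.
  - by move=> x /vP[].
  - by apply/allP => x /vP[].
  - by move=> x /uP[].
  - by apply/allP => x /uP[].
  apply/andP; split; last first.
    apply/allrelP => x y; rewrite mem_rev => xt yv; apply/asboolP.
    have := tv _ _ xt yv; move: xt yv; rewrite tP => /andP[xE _] /vP[yE py _].
    exact: Ou.
  apply/andP; split; apply/allrelP => x y xu; rewrite ?mem_rev => yt;
    apply/asboolP.
    have := ut _ _ xu yt; move: xu yt; rewrite tP => /uP[xE px _] /andP[yE _].
    exact: Ov.
  have := uv _ _ xu yt; move: xu yt => /uP[xE px _] /vP[yE py _].
  exact: Ov.
exists u, t, v, p; split=> //.
- exact: enumerates_uniq es es1.
- exact: enumerates_uniq es' es2.
- have x0t : x0 \in t by rewrite tP x0E px0 eqxx.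
  have y0t : y0 \in t by rewrite tP y0E py0 eqxx.
  case: t x0t y0t {tP utv mem_utv perm_utv perm_utv' ut tv es1 es2} => [//|a [|b w]] //.
  by rewrite !inE => /eqP e /eqP e'; rewrite e e' eqxx in xy0.
Qed.


Lemma glue_iff A O O' tau tau' x y : (A x -> A y -> (O x y <-> O' x y)) ->
  (~ A x -> ~ A y -> (tau x y <-> tau' x y)) ->
  (glue A O tau x y <-> glue A O' tau' x y).
Proof.
move=> h h'; split=> -[[Ax xy]|[Ax [Ay xy]]].
- by left; split=> // Ay; apply/h/xy.
- by right; do 2 split=> //; apply/h'.
- by left; split=> // Ay; apply/h/xy.
- by right; do 2 split=> //; apply/h'.
Qed.

Notation slope0 := (slope ev f0).
Notation slope_order0 := (slope_order ev f0).

Definition tie_order A k T tau := glue A (slope_order0 k T) tau.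

Lemma slope_orderE k T x y : slope0 k x = slope0 k y ->
  slope_order0 k T x y = T (slope0 k x) x y.
Proof.
move=> e; apply/propext; split=> [[|[]//]|h]; first by rewrite e ltxx.
by right.
Qed.

Lemma slope_order_neq k T x y : slope0 k x != slope0 k y ->
  slope_order0 k T x y = (slope0 k x < slope0 k y) :> Prop.
Proof.
move=> /eqP xy; apply/propext; split=> [[//|[]//]|h]; by left.
Qed.

(* The roots of slope [c] for [k] lie on the plane [k - c *: f0 = 0], on which
   any two reflection orders are equal or opposite. *)
Lemma connected_tie A k tau c T T' :
  (forall d, total_order (T d)) -> (forall d, total_order (T' d)) ->
  (forall d, d != c -> T d = T' d) -> (forall d, k != d *: f0) ->
  (forall x x' y, x \in E -> x' \in E -> y \in E -> x != x' -> A x -> A x' ->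
     slope0 k x = slope0 k x' -> slope0 k x = slope0 k y -> A y) ->
  extendable (tie_order A k T tau) -> extendable (tie_order A k T' tau) ->
  connected_orders (tie_order A k T tau) (tie_order A k T' tau).
Proof.
move=> oT oT' TT' kf0 mixed rT rT'.
pose p := k - c *: f0.
have p0 : p != 0 by rewrite subr_eq0.
have pE x : x \in E -> (ev p x == 0) = (slope0 k x == c).
  move=> xE; have fx := f0X (EX xE).
  have fx0 : ev f0 x != 0 by rewrite gt_eqF.
  by rewrite /slope !dotE subr_eq0 -(inj_eq (mulIf fx0) (_ / _)) divfK.
have same x y : slope0 k y != c ->
    (slope_order0 k T x y <-> slope_order0 k T' x y) /\
    (slope_order0 k T y x <-> slope_order0 k T' y x).
  move=> yc; have [e|ne] := eqVneq (slope0 k x) (slope0 k y).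
    have xc : slope0 k x != c by rewrite e.
    by rewrite !(slope_orderE _ e) !(slope_orderE _ (esym e)) !TT'.
  by rewrite !slope_order_neq// eq_sym.
pose cls := [pred x | [&& x \in E, slope0 k x == c & `[< A x >]]].
have clsP x : x \in cls -> [/\ x \in E, slope0 k x = c & A x].
  by rewrite inE => /and3P[xE /eqP xc /asboolP].
have clsI x : x \in E -> slope0 k x = c -> A x -> x \in cls.
  by move=> xE xc Ax; apply/and3P; split=> //; [apply/eqP|apply/asboolP].
have agr : {in cls &, forall x y, x != y -> (T c x y <-> T' c x y)} ->
    connected_orders (tie_order A k T tau) (tie_order A k T' tau).
  move=> h; apply: connected_orders_agree => // x y xE yE.
  apply: glue_iff => // Ax Ay.
  have [yc|yc] := eqVneq (slope0 k y) c; last by case: (same x y yc).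
  have [xc|xc] := eqVneq (slope0 k x) c; last by case: (same y x xc).
  have [->|xy] := eqVneq x y.
    by split=> [/(slope_order_irr oT (EX yE))|/(slope_order_irr oT' (EX yE))].
  rewrite !slope_orderE ?xc ?yc//; apply: h => //; exact: clsI.
have clsX x : x \in cls -> X x /\ ev p x = 0.
  by move=> /clsP[xE xc _]; split; [exact: EX|apply/eqP; rewrite pE// xc].
(* On the part of the class in [A] the two tie-breakings agree or are opposite. In the second case,
   once that part has two elements, [mixed] puts all roots of [E] on the plane into [A], and
   [flip_plane] applies. *)
case: (order_same_or_opposite dimM f0X Xred (oT c) (oT' c) p0 clsX).
  exact: agr.
move=> opp.
have [[x0 [y0 [x0c y0c xy0]]]|none] :=
    pselect (exists x y, [/\ x \in cls, y \in cls & x != y]); last first.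
  by apply: agr => x y xc yc xy; case: none; exists x, y.
have [x0E sx0 Ax0] := clsP _ x0c; have [y0E sy0 Ay0] := clsP _ y0c.
have clsA x : x \in E -> ev p x = 0 -> slope0 k x = c /\ A x.
  move=> xE /eqP; rewrite pE// => /eqP xc; split=> //.
  by apply: (mixed x0 y0 x) => //; rewrite sx0 ?sy0 ?xc.
apply: (@flip_plane _ _ p x0 y0) => //.
- by have [] := clsX _ x0c.
- by have [] := clsX _ y0c.
- move=> x y xE yE py.
  have yc : slope0 k y != c by rewrite -pE.
  by split; apply: glue_iff => // Ax Ay; case: (same x y yc).
- move=> x y xE yE /(clsA _ xE)[xc Ax] /(clsA _ yE)[yc Ay] xy.
  have h : T c x y <-> T' c y x by apply: opp => //; exact: clsI.
  split=> [[[_ /(_ Ay)]|[]//]|[[_ /(_ Ax)]|[]//]].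
    rewrite slope_orderE ?xc ?yc// => /h xy'; left; split=> // _.
    by rewrite slope_orderE ?xc ?yc.
  rewrite slope_orderE ?xc ?yc// => /h xy'; left; split=> // _.
  by rewrite slope_orderE ?xc ?yc.
- move=> x z y xE yE zE /(clsA _ xE)[xc Ax] /(clsA _ zE)[zc Az] py.
  have yc : slope0 k y != c by rewrite -pE.
  split=> [[[_ xy]|[]//]|[[Ay /(_ Ax) xy]|[_ []]//]].
    left; split=> // Ay; have := xy Ay.
    by rewrite !slope_order_neq ?xc ?zc// eq_sym.
  left; split=> // _; move: xy.
  by rewrite !slope_order_neq ?xc ?zc.
Qed.

(** Only finitely many slopes occur on [E], so the tie-breaking can be replaced one slope at a
    time. *)
Lemma connected_ties A k tau T T' :
  (forall d, total_order (T d)) -> (forall d, total_order (T' d)) ->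
  (forall d, k != d *: f0) ->
  (forall x x' y, x \in E -> x' \in E -> y \in E -> x != x' -> A x -> A x' ->
     slope0 k x = slope0 k x' -> slope0 k x = slope0 k y -> A y) ->
  (forall S, (forall d, total_order (S d)) -> extendable (tie_order A k S tau)) ->
  connected_orders (tie_order A k T tau) (tie_order A k T' tau).
Proof.
move=> oT oT' kf0 mixed ext.
pose S (l : seq R) c := if c \in l then T' c else T c.
have oS l c : total_order (S l c) by rewrite /S; case: ifP.
have cS l : connected_orders (tie_order A k T tau) (tie_order A k (S l) tau).
  elim: l => [|c l IHl].
    by apply: connected_orders_agree; [exact: ext|].
  apply: (connected_orders_trans (ext _ (oS l)) IHl).
  apply: (@connected_tie _ _ _ c) => //; try exact: ext.
  by move=> d dc; rewrite /S inE (negPf dc).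
apply: (connected_orders_trans (ext _ (oS (map (slope0 k) E))) (cS _)).
apply: connected_orders_agree; first exact: ext.
move=> x y xE yE; apply: glue_iff => // _ _.
by rewrite /slope_order /S map_f.
Qed.

(** * Sliding a functional *)

Section Slide.
Variables (k0 k1 : M) (A : set M) (tau T0 : M -> M -> Prop).
Hypothesis oT0 : total_order T0.
Let k (s : R) : M := (1 - s) *: k0 + s *: k1.
Hypothesis kf0 : forall s : R, 0 <= s <= 1 -> forall d, k s != d *: f0.
Hypothesis mixed : forall s : R, 0 <= s <= 1 ->
  forall x x' y, x \in E -> x' \in E -> y \in E -> x != x' -> A x -> A x' ->
  slope0 (k s) x = slope0 (k s) x' -> slope0 (k s) x = slope0 (k s) y -> A y.
Hypothesis ext : forall s : R, 0 <= s <= 1 -> forall S,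
  (forall d, total_order (S d)) -> extendable (tie_order A (k s) S tau).

Let Q s := tie_order A (k s) (fun=> T0) tau.

Let gap x y s := slope0 (k s) y - slope0 (k s) x.

(** The denominators of the slopes do not depend on the parameter, so each gap is affine in it and
    changes sign at most once. *)
Lemma gapE x y s : gap x y s = (1 - s) * gap x y 0 + s * gap x y 1.
Proof. by rewrite /gap /k /slope !dotE; ring. Qed.

(** The zeros of the affine gaps. For a constant gap the quotient is [0] by convention, a harmless
    extra value. *)
Let critical := [seq gap x y 0 / (gap x y 0 - gap x y 1) | x <- E, y <- E].

(** A gap positive at [s] can become nonpositive at [m] only through a zero at [m] or strictly
    between the two; [s] itself may be critical for other pairs. *)
Lemma gap_sign (s m : R) x y : x \in E -> y \in E ->
  (forall z, z \in critical -> ~~ (Num.min s m < z < Num.max s m) /\ z != m) ->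
  0 < gap x y s -> 0 < gap x y m.
Proof.
move=> xE yE crit; rewrite (gapE _ _ s) (gapE _ _ m).
set a := gap x y 0; set b := gap x y 1 => s0.
rewrite ltNge; apply/negP => m0.
have ab : a - b != 0.
  by apply/eqP => ab; move: s0 m0; rewrite (_ : b = a); lra.
have zc : a / (a - b) \in critical by apply/allpairsP; exists (x, y).
have [] := crit _ zc; have za : a / (a - b) * (a - b) = a by rewrite divfK.
set z := a / (a - b) in za *.
have es : (z - s) * (a - b) > 0 by rewrite mulrBl za; lra.
have em : (z - m) * (a - b) <= 0 by rewrite mulrBl za; lra.
case: (ltgtP z m) => // zm.
- move=> /negP nz _; apply: nz.
  have ab0 : 0 < a - b.
    by rewrite lt0r ab /=; rewrite nmulr_rle0 ?subr_lt0// in em.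
  rewrite pmulr_lgt0// subr_gt0 in es.
  by rewrite gt_min es lt_max zm orbT.
- move=> /negP nz _; apply: nz.
  have ab0 : a - b < 0.
    by rewrite lt_neqAle ab /=; rewrite pmulr_rle0 ?subr_gt0// in em.
  rewrite nmulr_lgt0// subr_lt0 in es.
  by rewrite gt_min zm orbT lt_max es.
Qed.

(** Strict inequalities of slopes at either end persist at the midpoint [m]. So the order at an end,
    with its ties broken by the midpoint order, equals the midpoint order on [E], and only the
    tie-breaking has to be changed. *)
Lemma slide_noncritical (s s' : R) : 0 <= s -> s < s' -> s' <= 1 ->
  (forall z, z \in critical -> ~~ (s < z < s')) -> connected_orders (Q s) (Q s').
Proof.
move=> s0 ss' s1 crit.
pose m := (s + s') / 2.
have sm : s < m by rewrite /m; lra.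
have ms : m < s' by rewrite /m; lra.
have m01 : 0 <= m <= 1 by apply/andP; split; lra.
pose S (d : R) := slope_order0 (k m) (fun=> T0).
have oS d : total_order (S d) by apply: slope_total_interval_order.
have critm t z : z \in critical -> t = s \/ t = s' ->
    ~~ (Num.min t m < z < Num.max t m) /\ z != m.
  move=> zc tt; have zs := crit _ zc; split; last first.
    by apply: contra zs => /eqP ->; rewrite sm ms.
  apply: contra zs; case: tt => ->.
    rewrite (min_l (ltW sm)) (max_r (ltW sm)) => /andP[-> /=].
    by move=> h; exact: lt_trans h ms.
  rewrite (min_r (ltW ms)) (max_l (ltW ms)) => /andP[h ->].
  by rewrite andbT; exact: lt_trans sm h.
have near t : t = s \/ t = s' -> 0 <= t <= 1 /\ connected_orders (Q t) (Q m).
  move=> tt; have t01 : 0 <= t <= 1 by case: tt => ->; apply/andP; split; lra.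
  split=> //.
  apply: (connected_orders_trans (ext t01 oS)).
    by apply: connected_ties => //; [exact: kf0|exact: mixed|exact: ext].
  apply: connected_orders_agree; first exact: ext.
  move=> x y xE yE; apply: glue_iff => // _ _.
  have gs u v : u \in E -> v \in E -> slope0 (k t) u < slope0 (k t) v ->
      slope0 (k m) u < slope0 (k m) v.
    move=> uE vE; rewrite -subr_gt0 => /(gap_sign uE vE (fun z zc => critm t z zc tt)).
    by rewrite subr_gt0.
  have [xy|xy|xy] := ltgtP (slope0 (k t) x) (slope0 (k t) y).
  - by split=> _; left => //; apply: gs.
  - have yx := gs _ _ yE xE xy.
    split=> [[|[e]]|[|[e]]].
    + by rewrite ltNge ltW.
    + by rewrite e ltxx in xy.
    + by rewrite ltNge ltW.
    + by rewrite e ltxx in yx.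
  - split=> [[|[_ //]]|h]; first by rewrite xy ltxx.
    by right.
have [s01 c1] := near s (or_introl erefl).
have [s01' c2] := near s' (or_intror erefl).
by apply: connected_orders_trans c1 (connected_orders_sym c2); apply: ext.
Qed.

(** Induction on the number of critical values strictly inside the interval: cutting at one of them
    lowers the count on both sides, as it becomes an endpoint. *)
Lemma slide : connected_orders (Q 0) (Q 1).
Proof.
suff main n (s s' : R) : 0 <= s -> s < s' -> s' <= 1 ->
    (count (fun z => (s < z < s')%R) critical <= n)%N -> connected_orders (Q s) (Q s').
  by apply: (main _ 0 1) => //.
elim: n s s' => [|n IHn] s s' s0 ss' s1 cn.
  apply: slide_noncritical => // z zc.
  move: cn; rewrite leqn0 eqn0Ngt -has_count => /hasPn; exact.
have [/hasP[z zc /andP[sz zs]]|nh] := boolP (has (fun z => s < z < s') critical).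
  have z01 : 0 <= z <= 1 by apply/andP; split; lra.
  have cz (a b : R) : s <= a -> b <= s' -> ~~ (a < z < b) ->
      (count (fun z => (a < z < b)%R) critical <= n)%N.
    move=> sa bs nz; rewrite -ltnS; apply: leq_trans cn.
    apply: (count_sub_lt _ zc) => //; last by rewrite sz zs.
    by move=> w /andP[aw wb]; rewrite (le_lt_trans sa aw) (lt_le_trans wb bs).
  apply: (connected_orders_trans (ext z01 (fun=> oT0))).
    by apply: IHn => //; [lra|apply: cz; rewrite ?ltxx ?andbF//; lra].
  by apply: IHn => //; [lra|apply: cz; rewrite ?ltxx//; lra].
apply: slide_noncritical => // z zc; exact: (hasPn nh).
Qed.

End Slide.

(** * Polygonal paths and their straightening *)

Section Chain.
Variable T0 : M -> M -> Prop.
Hypothesis oT0 : total_order T0.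
Notation negset := (negset ev X).
Notation above := (above ev X).

Lemma glueTT A O tau x y : A x -> A y -> glue A O tau x y = O x y.
Proof.
by move=> Ax Ay; apply/propext; split=> [[[_ /(_ Ay)]|[/(_ Ax)]]|]//; left.
Qed.

Lemma glueTF A O tau x y : A x -> ~ A y -> glue A O tau x y = True.
Proof. by move=> Ax Ay; apply/propext; split=> // _; left. Qed.

Lemma glueFT A O tau x y : ~ A x -> A y -> glue A O tau x y = False.
Proof. by move=> Ax Ay; apply/propext; split=> [[[/Ax]|[_ [/(_ Ay)]]]|]. Qed.

Lemma glueFF A O tau x y : ~ A x -> ~ A y -> glue A O tau x y = tau x y.
Proof.
by move=> Ax Ay; apply/propext; split=> [[[/Ax]|[_ []]]|]//; right.
Qed.

(* The order in which the roots outside [negset g] are crossed along the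
   polygonal path [g :: fs], continued by a sweep. *)
Fixpoint path_order g (fs : seq M) : M -> M -> Prop :=
  if fs is h :: fs' then
    glue (negset h) (slope_order ev (- h) g (fun=> T0)) (path_order h fs')
  else slope_order0 g (fun=> T0).

(** The second clause lets each segment cross at most one root of [E]. This is what makes the bend
    at the sliding node invisible on [E] in [bent_agree]. *)
Fixpoint root_path g (fs : seq M) : Prop :=
  if fs is h :: fs' then
    [/\ above g h, {in E &, forall x y, negset h x -> ~ negset g x ->
          negset h y -> ~ negset g y -> x = y} & root_path h fs']
  else True.

Lemma above_sub g h : above g h -> negset g `<=` negset h.
Proof. by move=> gh x [Xx gx]; split=> //; apply/gh/ltW. Qed.

Lemma path_interval_order g fs : root_path g fs ->
  interval_order X (negset g) X (path_order g fs).
Proof.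
elim: fs g => [|h fs IHfs] g /=.
  move=> _; apply: total_interval_orderR; first exact: negset_biconvex.
    exact: slope_total_interval_order.
  by move=> x y gx Xy gy; exact: slope_order_init f0X gx Xy gy.
move=> [gh _ hfs]; apply: interval_order_glue (IHfs _ hfs) => //.
- exact: negset_biconvex.
- exact: above_sub.
- exact: negset_sub.
- exact: segment_interval_order.
Qed.

Lemma root_path_last g fs w : root_path g fs -> X w ->
  0 <= ev (last g fs) w -> 0 <= ev g w.
Proof.
elim: fs g => [//|h fs IHfs] g /= [gh _ hfs] Xw /(IHfs _ hfs Xw) hw.
by rewrite leNgt; apply/negP => /ltW /(gh _ Xw); rewrite ltNge hw.
Qed.

Lemma swept_total_order g fs S : root_path g fs ->
  (forall d, total_order (S d)) ->
  total_order (glue (negset g) (slope_order0 g S) (path_order g fs)).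
Proof.
move=> gfs oS; apply: interval_order_glue (path_interval_order gfs) => //.
- exact: negset_biconvex.
- exact: negset_sub.
- apply: total_interval_orderL; first exact: negset_biconvex.
    exact: slope_total_interval_order.
  by move=> x y gx Xy gy; exact: slope_order_init f0X gx Xy gy.
Qed.

Section Step.
Variables (g h : M) (fs : seq M).
Hypothesis gh : above g h.
Hypothesis gh1 : {in E &, forall x y, negset h x -> ~ negset g x ->
  negset h y -> ~ negset g y -> x = y}.
Hypothesis hfs : root_path h fs.
Let k (s : R) : M := (1 - s) *: g + s *: h.

Let kE s x : ev (k s) x = (1 - s) * ev g x + s * ev h x.
Proof. by rewrite /k !dotE. Qed.

Lemma segment_sub s : 0 <= s <= 1 -> negset (k s) `<=` negset h.
Proof.
move=> /andP[s0 s1] x [Xx]; rewrite kE => kx; split=> //.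
rewrite ltNge; apply/negP => hx.
have gx : 0 < ev g x by rewrite ltNge; apply/negP => /(gh Xx); rewrite ltNge hx.
by move: kx; rewrite ltNge => /negP; apply; rewrite addr_ge0// mulr_ge0// ?subr_ge0// ltW.
Qed.

Lemma segment_sup s : 0 <= s <= 1 -> negset g `<=` negset (k s).
Proof.
move=> /andP[s0 s1] x [Xx gx]; split=> //; rewrite kE.
have hx : ev h x < 0 by apply/gh/ltW.
nra.
Qed.

(* The reflection order of the path [f0], [k s], [h], [fs]; ties on its first
   segment are broken by [S]. *)
Let bent s (S : R -> M -> M -> Prop) := glue (negset (k s)) (slope_order0 (k s) S)
  (glue (negset h) (slope_order ev (- h) (k s) (fun=> T0)) (path_order h fs)).

Lemma bent_total_order s S : 0 <= s <= 1 -> (forall d, total_order (S d)) ->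
  total_order (bent s S).
Proof.
move=> s01 oS; have [s0 s1] := andP s01.
apply: (@interval_order_glue _ _ _ _ (negset (k s))) => //.
- exact: negset_biconvex.
- exact: negset_sub.
- apply: total_interval_orderL; first exact: negset_biconvex.
    exact: slope_total_interval_order.
  by move=> x y gx Xy gy; exact: slope_order_init f0X gx Xy gy.
apply: interval_order_glue (path_interval_order hfs) => //.
- exact: negset_biconvex.
- exact: segment_sub.
- exact: negset_sub.
(* At [s = 1] the middle segment is a point, and [above] could fail for roots vanishing at [h]. *)
have [s1'|s1'] := eqVneq s 1.
  rewrite (_ : k s = h); first exact: interval_order_refl.
  by rewrite /k s1' subrr scale0r scale1r add0r.
apply: segment_interval_order => // x Xx; rewrite kE => kx.
rewrite ltNge; apply/negP => hx.
have gx : 0 < ev g x by rewrite ltNge; apply/negP => /(gh Xx); rewrite ltNge hx.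
have s1'' : s < 1 by rewrite lt_neqAle s1'.
nra.
Qed.

(** A root nonnegative at [k s] is not in [negset g], so inside [negset h] there is at most one such
    root of [E]. The slope along [k s] already puts it last, as the second segment does. *)
Lemma bent_agree s S : 0 <= s <= 1 -> (forall d, total_order (S d)) ->
  agree (bent s S) (tie_order (negset h) (k s) S (path_order h fs)).
Proof.
move=> s01 oS x y xE yE; rewrite /bent /tie_order.
have Xx := EX xE; have Xy := EX yE.
have kh := segment_sub s01; have gk := segment_sup s01.
have [hx|hx] := pselect (negset h x); have [hy|hy] := pselect (negset h y).
- rewrite [X in _ <-> X]glueTT//.
  have [kx|kx] := pselect (negset (k s) x); have [ky|ky] := pselect (negset (k s) y).
  + by rewrite glueTT.
  + by rewrite glueTF//; split=> // _; exact: (slope_order_init _ f0X).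
  + rewrite glueFT//; split=> // xy.
    have yx := @slope_order_init _ _ ev X f0 (k s) S y x f0X ky Xx kx.
    exact: (slope_order_irr oS Xx (slope_order_trans oS Xx Xy Xx xy yx)).
  + rewrite glueFF// glueTT//.
    have <- : x = y by apply: gh1 => // /gk.
    have oT (d : R) := oT0.
    by split=> [/(slope_order_irr oT Xx)|/(slope_order_irr oS Xx)].
- rewrite [X in _ <-> X]glueTF//.
  have ky : ~ negset (k s) y by move/kh.
  have [kx|kx] := pselect (negset (k s) x); first by rewrite glueTF.
  by rewrite glueFF// glueTF.
- rewrite [X in _ <-> X]glueFT//.
  have kx : ~ negset (k s) x by move/kh.
  have [ky|ky] := pselect (negset (k s) y); first by rewrite glueFT.
  by rewrite glueFF// glueFT.
- have kx : ~ negset (k s) x by move/kh.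
  have ky : ~ negset (k s) y by move/kh.
  by rewrite !glueFF.
Qed.

Lemma connected_step : (exists x, negset g x) -> (exists2 w, X w & 0 <= ev h w) ->
  connected_orders
    (glue (negset g) (slope_order0 g (fun=> T0)) (path_order g (h :: fs)))
    (glue (negset h) (slope_order0 h (fun=> T0)) (path_order h fs)).
Proof.
move=> [a [Xa ga]] [w Xw hw].
have ha : ev h a < 0 by apply/gh/ltW.
have gw : 0 < ev g w by rewrite ltNge; apply/negP => /(gh Xw); rewrite ltNge hw.
have k0 : k 0 = g by rewrite /k subr0 scale1r scale0r addr0.
have k1 : k 1 = h by rewrite /k subrr scale1r scale0r add0r.
have c01 : (0 : R) <= (0 : R) <= (1 : R) by rewrite !lexx ?ler01.
have oT (d : R) := oT0.
have ext s : 0 <= s <= 1 -> forall S, (forall d, total_order (S d)) ->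
    extendable (tie_order (negset h) (k s) S (path_order h fs)).
  move=> s01 S oS; apply: extendable_agree (bent_agree s01 oS) _.
  by apply: total_order_extendable; apply: bent_total_order => //.
apply: (@connected_orders_trans _
  (tie_order (negset h) (k 0) (fun=> T0) (path_order h fs))).
- exact: ext.
- apply: connected_orders_agree.
    by apply: total_order_extendable; apply: swept_total_order => //.
  by have := bent_agree c01 oT; rewrite /bent k0.
suff : connected_orders (tie_order (negset h) (k 0) (fun=> T0) (path_order h fs))
    (tie_order (negset h) (k 1) (fun=> T0) (path_order h fs)) by rewrite k1.
apply: slide => //.
(* Every [k s] is negative at [a] and nonnegative at [w], whereas [f0] is positive at both, so they
   are not proportional. *)
- move=> s /andP[s0 s1] d; apply/eqP => kd.
  have := kE s w; have := kE s a; rewrite /k kd !dotE.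
  have fa := f0X Xa; have fw := f0X Xw => ea ew.
  have : 0 <= d * ev f0 w by rewrite ew; nra.
  rewrite pmulr_lge0// => d0.
  have : d * ev f0 a < 0 by rewrite ea; nra.
  by rewrite ltNge mulr_ge0// ltW.
(* One of [x], [x'] is negative at [g], as only one root of [E] is crossed from [g] to [h]. The
   common slope is then negative, which puts [y] in [negset (k s)]. *)
- move=> s s01 x x' y xE x'E yE xx' hx hx' sxx' sxy.
  have Xx := EX xE; have Xx' := EX x'E; have Xy := EX yE.
  apply: contrapT => hy.
  have ky : 0 <= slope0 (k s) y.
    rewrite leNgt slope_neg ?f0X//; apply/negP => ky; apply: hy.
    by apply: (segment_sub s01).
  have neg z : X z -> negset g z -> slope0 (k s) z < 0.
    by move=> Xz /(segment_sup s01)[_]; rewrite slope_neg// f0X.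
  have [gx|gx] := pselect (negset g x).
    by have := neg _ Xx gx; rewrite sxy ltNge ky.
  have [gx'|gx'] := pselect (negset g x').
    by have := neg _ Xx' gx'; rewrite -sxx' sxy ltNge ky.
  by move: xx'; rewrite (gh1 xE x'E hx gx hx' gx') eqxx.
Qed.

End Step.

(** Each use of [connected_step] removes the first bend. A root negative at the first node and one
    nonnegative at the last keep these signs at all nodes, so its two existence hypotheses
    persist. *)
Lemma connected_path g fs : root_path g fs -> (exists x, negset g x) ->
  (exists2 w, X w & 0 <= ev (last g fs) w) ->
  connected_orders (glue (negset g) (slope_order0 g (fun=> T0)) (path_order g fs))
    (slope_order0 (last g fs) (fun=> T0)).
Proof.
have oT (d : R) := oT0.
elim: fs g => [|h fs IHfs] g /=.
  move=> _ _ _; apply: connected_orders_agree.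
    by apply: total_order_extendable; apply: (@swept_total_order _ [::]) => //.
  move=> x y xE yE.
  have Xx := EX xE; have Xy := EX yE.
  have [gx|gx] := pselect (negset g x); have [gy|gy] := pselect (negset g y).
  - by rewrite glueTT.
  - by rewrite glueTF//; split=> // _; exact: (slope_order_init _ f0X).
  - rewrite glueFT//; split=> // xy.
    have yx := @slope_order_init _ _ ev X f0 g (fun=> T0) y x f0X gy Xx gx.
    exact: (slope_order_irr oT Xx (slope_order_trans oT Xx Xy Xx xy yx)).
  - by rewrite glueFF.
move=> [gh gh1 hfs] ng [w Xw lw].
have hw := root_path_last hfs Xw lw.
apply: (@connected_orders_trans _
  (glue (negset h) (slope_order0 h (fun=> T0)) (path_order h fs))).
- by apply: total_order_extendable; apply: swept_total_order => //.
- by apply: connected_step => //; exists w.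
apply: IHfs => //; last by exists w.
by have [x gx] := ng; exists x; apply: above_sub gh _ gx.
Qed.

Lemma connected_slopes g g' : (forall d, g != d *: f0) ->
  (forall d, g' != d *: f0) ->
  connected_orders (slope_order0 g (fun=> T0)) (slope_order0 g' (fun=> T0)).
Proof.
move=> gf g'f; have oT (d : R) := oT0.
have slo_ext k S : (forall d, total_order (S d)) -> extendable (slope_order0 k S).
  by move=> oS; apply: total_order_extendable; apply: slope_total_interval_order => //.
have main k0 k1 : (forall s : R, 0 <= s <= 1 -> forall d,
      (1 - s) *: k0 + s *: k1 != d *: f0) ->
    connected_orders (slope_order0 k0 (fun=> T0)) (slope_order0 k1 (fun=> T0)).
  move=> kf.
  (* With [X] as first part, the glued order is the pure slope order on [E], and [slide] applies to
     the whole sweep. *)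
  pose tau (x y : M) := False.
  have all_agree k S : agree (slope_order0 k S) (tie_order X k S tau).
    by move=> x y xE yE; rewrite /tie_order glueTT//; exact: EX.
  have ext k S : (forall d, total_order (S d)) -> extendable (tie_order X k S tau).
    by move=> /(slo_ext k); apply/extendable_agree/all_agree.
  have := @slide k0 k1 X tau T0 oT0 kf.
  rewrite subr0 subrr !scale1r !scale0r addr0 add0r => sl.
  apply: (connected_orders_trans (ext k0 _ oT)).
    by apply: connected_orders_agree; [exact: slo_ext|].
  apply: (connected_orders_trans (ext k1 _ oT)); last first.
    apply: connected_orders_agree; first exact: ext.
    exact/agree_sym/all_agree.
  apply: sl => [s _ x x' y _ _ yE _ _ _ _ _|s _ S oS]; first exact: EX.
  exact: ext.
have [nice|] := pselect (forall s : R, 0 <= s <= 1 -> forall d,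
      (1 - s) *: g + s *: g' != d *: f0); first exact: main.
(* Otherwise [g'] lies in the plane of [f0] and [g]: make a detour through the
   normal [p] of this plane. *)
move=> /existsNP[s /not_implyP[s01 /existsNP[d /negP]]]; rewrite negbK => /eqP e.
have [p p0 [pf pg]] := exists_orth ev dimM f0 g.
have pg' : ev p g' = 0.
  have : ev p ((1 - s) *: g + s *: g') = 0 by rewrite e dotZr pf mulr0.
  rewrite !dotE pg mulr0 add0r => /eqP; rewrite mulf_eq0 => /orP[/eqP s0|/eqP//].
  by have := gf d; rewrite -e s0 subr0 scale1r scale0r addr0 eqxx.
have pp : ev p p != 0 by rewrite dot_eq0.
apply: (@connected_orders_trans _ (slope_order0 p (fun=> T0))).
- exact: slo_ext.
- apply: main => t t01 c; apply/eqP => e'.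
  have /eqP : ev p ((1 - t) *: g + t *: p) = 0 by rewrite e' dotZr pf mulr0.
  rewrite !dotE pg mulr0 add0r mulf_eq0 (negPf pp) orbF => /eqP t0.
  by have := gf c; rewrite -e' t0 subr0 scale1r scale0r addr0 eqxx.
- apply: main => t t01 c; apply/eqP => e'.
  have /eqP : ev p ((1 - t) *: p + t *: g') = 0 by rewrite e' dotZr pf mulr0.
  rewrite !dotE pg' mulr0 addr0 mulf_eq0 (negPf pp) orbF => /eqP t0.
  have := g'f c; rewrite -e' t0 scale0r add0r.
  have -> : t = 1 by lra.
  by rewrite scale1r eqxx.
Qed.

(* The functionals [F i] are the nodes of a polygonal path crossing the
   elements of [s] one at a time. *)
Definition separated (s : seq M) := exists F : nat -> M,
  (forall i j, (i.+1 < size s)%N -> (j < size s)%N ->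
     (ev (F i) s`_j < 0) = (j <= i)%N) /\
  (forall i, (i.+2 < size s)%N -> above (F i) (F i.+1)).

Lemma connected_separated s : perm_eq s E -> (1 < size s)%N -> separated s ->
  exists g O, [/\ forall d, g != d *: f0, extendable O, enumerates O s &
    connected_orders O (slope_order0 g (fun=> T0))].
Proof.
move=> sE s1 [F [Fneg Fab]].
have us : uniq s by rewrite (perm_uniq sE).
have Es j : (j < size s)%N -> s`_j \in E by move=> js; rewrite -(perm_mem sE) mem_nth.
have Xs j : (j < size s)%N -> X s`_j by move/Es/EX.
pose fs i m := map F (iota i.+1 m).
have negF i j : (i.+1 < size s)%N -> (j < size s)%N ->
    negset (F i) s`_j <-> (j <= i)%N.
  move=> ii js; rewrite -Fneg//; split=> [[]//|h]; split=> //; exact: Xs.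
have path m i : (i + m).+2 = size s -> root_path (F i) (fs i m).
  elim: m i => [//|m IHm] i ims; split.
  - by apply: Fab; rewrite -ims addnS !ltnS leq_addr.
  - have iS : (i.+2 < size s)%N by rewrite -ims addnS !ltnS leq_addr.
    have eq1 x : x \in E -> negset (F i.+1) x -> ~ negset (F i) x -> x = s`_i.+1.
      rewrite -(perm_mem sE) => /(nthP 0)[j js <-].
      rewrite !negF ?(ltnW iS)// => /[swap] /negP; rewrite -ltnNge => ij ji.
      by congr nth; apply/eqP; rewrite eqn_leq ji ij.
    move=> x y xE yE hx gx hy gy.
    by rewrite (eq1 x)// (eq1 y).
  - by apply: IHm; rewrite addSnnS.
have lastF m i : last (F i) (fs i m) = F (i + m)%N.
  elim: m i => [|m IHm] i; first by rewrite addn0.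
  by rewrite /= IHm addSnnS.
have pathO m i j j' : (i + m).+2 = size s -> (i < j < j')%N -> (j' < size s)%N ->
    path_order (F i) (fs i m) s`_j s`_j'.
  elim: m i => [|m IHm] i ims /andP[ij jj'] js.
    by move: js; rewrite -ims addn0; lia.
  have iS : (i.+2 < size s)%N by rewrite -ims addnS !ltnS leq_addr.
  have j's : (j < size s)%N by lia.
  have nj' : ~ negset (F i.+1) s`_j' by rewrite negF//; lia.
  rewrite /=; have [ji|ji] := leqP j i.+1.
    by rewrite glueTF// negF.
  rewrite glueFF//; last by rewrite negF//; lia.
  by apply: IHm => //; [rewrite addSnnS|rewrite ji].
have s0 : (0 < size s)%N by exact: ltnW.
(* The nodes [F 0] to [F m] account for all elements of [s] but the last; that one is left to the
   final sweep and provides the root nonnegative at the last node. *)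
pose m := (size s - 2)%N.
have m0 : (0 + m).+2 = size s by rewrite /m; lia.
have lm : (m.+1 < size s)%N by rewrite -m0.
exists (F m), (glue (negset (F 0)) (slope_order0 (F 0) (fun=> T0))
  (path_order (F 0) (fs 0%N m))).
have ng : exists x, negset (F 0) x by exists s`_0; rewrite negF.
have wl : 0 <= ev (F m) s`_m.+1 by rewrite leNgt Fneg// ltnn.
split.
- move=> d; apply/eqP => e; move: wl; rewrite e dotZl pmulr_lge0; last exact/f0X/Xs.
  move=> d0.
  have : ev (F m) s`_0 < 0 by rewrite Fneg.
  by rewrite e dotZl ltNge mulr_ge0//; exact/ltW/f0X/Xs.
- by apply: total_order_extendable; apply: swept_total_order => //; exact: path.
- split=> //; apply/(pairwiseP 0) => i j; rewrite !inE => ii jj ij.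
  have nj : ~ negset (F 0) s`_j by rewrite negF//; lia.
  case: i ii ij => [|i] ii ij; first by rewrite glueTF//; apply/negF.
  rewrite glueFF//; last by rewrite negF//; lia.
  exact: pathO.
- have wl' : exists2 w, X w & 0 <= ev (last (F 0) (fs 0%N m)) w.
    by exists s`_m.+1; [exact: Xs|rewrite lastF add0n].
  by have := connected_path (path m 0%N m0) ng wl'; rewrite lastF add0n.
Qed.

Lemma connected_all s s' : vertex s -> vertex s' -> separated s -> separated s' ->
  connected s s'.
Proof.
move=> [_ _ [sE _]] [_ _ [s'E _]] ss ss'.
have ps : perm_eq s s' by rewrite (permPl sE) perm_sym.
have [s1|s1] := leqP (size s) 1.
  suff -> : s = s' by exact: rt_refl.
  case: s ps s1 {sE ss} => [|a [|b s]] // ps _.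
    by move: (perm_size ps); case: (s').
  by apply/esym; apply: perm_small_eq => //; rewrite perm_sym.
have s'1 : (1 < size s')%N by rewrite -(perm_size ps).
have [g [O [gf rO eO cO]]] := connected_separated sE s1 ss.
have [g' [O' [g'f rO' eO' cO']]] := connected_separated s'E s'1 ss'.
have ext k : extendable (slope_order0 k (fun=> T0)).
  by apply: total_order_extendable; apply: slope_total_interval_order => //.
suff : connected_orders O O' by apply.
apply: connected_orders_trans cO _; first exact: ext.
apply: connected_orders_trans (connected_slopes gf g'f) _; first exact: ext.
exact: connected_orders_sym.
Qed.

End Chain.

End Lists.

(** * Separation of the initial sections *)

Section AffineDot.
Variables (R : realType) (V : vectType R) (ip : {dot V for idfun}).
Local Notation M := (affine_space V R).

(** Unlike [aff_ip], this form is nondegenerate: every functional is represented by a vector [f],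
    and [f.2] is its value at [delta]. *)
Definition aff_dot (u v : M) : R := ip u.1 v.1 + u.2 * v.2.

Fact aff_dot_bilinear :
  bilinear_for (GRing.Scale.Law.clone _ _ ( *%R ) _)
    (GRing.Scale.Law.clone _ _ (@idfun R \; *%R ) _) aff_dot.
Proof.
split=> [u' a u v|u a v w] /=; rewrite /aff_dot /=.
  by rewrite dotDl dotZl /GRing.scale /=; ring.
by rewrite dotDr dotZr /GRing.scale /=; ring.
Qed.

HB.instance Definition _ :=
  bilinear_isBilinear.Build R M M R _ _ aff_dot aff_dot_bilinear.

Fact aff_dot_hermitian (u v : M) :
  aff_dot u v = (-1) ^+ false * idfun (aff_dot v u).
Proof. by rewrite expr0 mul1r /aff_dot /= dotC mulrC. Qed.

HB.instance Definition _ :=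
  isHermitianSesquilinear.Build R M false idfun aff_dot aff_dot_hermitian.

Fact aff_dot_gt0 (u : M) : u != 0 -> 0 < aff_dot u u.
Proof.
case: u => u c; rewrite /aff_dot /= -expr2 => uc.
have [u0|/(dot_gt0 ip) u0] := eqVneq u 0; last first.
  by rewrite ltr_wpDr// sqr_ge0.
rewrite u0 dot0l add0r exprn_even_gt0//=; apply: contra uc => /eqP ->.
by rewrite u0.
Qed.

HB.instance Definition _ := isDotProduct.Build R M aff_dot aff_dot_gt0.

End AffineDot.

(** * Gordan's theorem with natural multiplicities *)

Section FourierMotzkin.
Variable R : realType.

Lemma exists_between (l u : seq R) :
  (forall x y, x \in l -> y \in u -> x < y) ->
  exists t, (forall x, x \in l -> x < t) /\ (forall y, y \in u -> t < y).
Proof.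
have maxP (w : seq R) : w != [::] -> exists2 m, m \in w & forall x, x \in w -> x <= m.
  elim: w => [//|a w IHw] _; have [->|/IHw[m mw mmax]] := eqVneq w [::].
    by exists a => [|x]; rewrite ?inE// => /eqP ->.
  exists (Num.max a m).
    by rewrite /Num.max; case: ifP; rewrite inE ?eqxx ?mw ?orbT.
  by move=> x; rewrite inE le_max => /orP[/eqP ->|/mmax ->]; rewrite ?lexx ?orbT.
move=> lu.
have [l0|/maxP[a al amax]] := eqVneq l [::].
  have [u0|] := eqVneq (map -%R u) [::].
    exists 0; rewrite l0; split=> // y yu.
    by have := map_f -%R yu; rewrite u0.
  move=> /maxP[b _ bmax]; exists (- b - 1); rewrite l0; split=> // y yu.
  have := bmax (- y); rewrite map_f// => /(_ isT); lra.
have [u0|] := eqVneq (map -%R u) [::].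
  exists (a + 1); split=> [x /amax|y yu]; first by lra.
  by have := map_f -%R yu; rewrite u0.
move=> /maxP[_ /mapP[b bu ->] bmax].
have ab := lu _ _ al bu.
exists ((a + b) / 2); split=> [x /amax|y yu]; first by lra.
have := bmax (- y); rewrite map_f// => /(_ isT); lra.
Qed.

Variable G : zmodType.

(** Nonempty sums with repetitions, that is, combinations with natural coefficients not all zero;
    summands can be replaced in them one at a time. *)
Inductive positive_sum (s : seq G) : G -> Prop :=
| positive_sum_mem v of v \in s : positive_sum s v
| positive_sumD v w of positive_sum s v & positive_sum s w :
    positive_sum s (v + w).

Lemma positive_sumMn s v n : positive_sum s v -> positive_sum s (v *+ n.+1).
Proof.
move=> sv; elim: n => [//|n IHn]; rewrite mulrSr; exact: positive_sumD.
Qed.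

Let absn (x : R) := `|Num.floor x|%N.

Let absnE x : x \is a Num.int -> (absn x)%:R = `|x|.
Proof.
by move=> xi; rewrite /absn natr_absz intr_norm floorK.
Qed.

(* Gordan's theorem with an integral certificate, by Fourier-Motzkin elimination
   of the last coordinate. *)
Lemma integral_gordan n (z : nat -> G -> R) (s : seq G) :
  (forall i, {morph z i : u v / u + v}) ->
  (forall i v, (i < n)%N -> v \in s -> z i v \is a Num.int) ->
  (exists f : nat -> R, forall v, v \in s -> 0 < \sum_(i < n) f i * z i v) \/
  (exists2 w, positive_sum s w & forall i, (i < n)%N -> z i w = 0).
Proof.
move=> zD; elim: n s => [|n IHn] s zint.
  case: s zint => [|v s] _; first by left; exists (fun=> 0).
  by right; exists v => //; apply: positive_sum_mem; rewrite inE eqxx.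
have z0 i : z i 0 = 0 by apply: (addrI (z i 0)); rewrite -zD !addr0.
have zMn i v m : z i (v *+ m) = z i v * m%:R.
  rewrite mulr_natr; elim: m => [|m IHm]; first by rewrite !mulr0n z0.
  by rewrite !mulrSr zD IHm.
(* Cross-multiplication cancels coordinate [n], which has opposite signs at [v] and [w]; integrality
   makes the multipliers natural numbers. *)
pose comb v w := v *+ absn (z n w) + w *+ absn (z n v).
pose s' := [seq v <- s | z n v == 0] ++
  [seq comb v w | v <- [seq v <- s | 0 < z n v], w <- [seq w <- s | z n w < 0]].
have absn_gt0 v : v \in s -> z n v != 0 -> exists m, absn (z n v) = m.+1.
  move=> vs zv; exists (absn (z n v)).-1; rewrite prednK// lt0n.
  by rewrite -(pnatr_eq0 R) absnE ?zint// normr_eq0.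
have s'P v : v \in s' ->
    (v \in s /\ z n v = 0) \/ exists x y, [/\ x \in s, 0 < z n x, y \in s,
      z n y < 0 & v = comb x y].
  rewrite mem_cat => /orP[|/allpairsP[[x y] /= []]].
    by rewrite mem_filter => /andP[/eqP zv vs]; left.
  rewrite !mem_filter => /andP[zx xs] /andP[zy ys] ->.
  by right; exists x, y.
have zcomb i v w : v \in s -> w \in s ->
    z i (comb v w) = z i v * `|z n w| + z i w * `|z n v|.
  move=> vs ws; rewrite zD !zMn !absnE//; exact: zint.
have sub v : positive_sum s' v -> positive_sum s v /\ z n v = 0.
  elim=> [{}v /s'P[[vs zv]|[x [y [xs zx ys zy ->]]]]|x y _ [sx zx] _ [sy zy]].
  - by split=> //; apply: positive_sum_mem.
  - split; last by rewrite zcomb// (gtr0_norm zx) (ltr0_norm zy); ring.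
    have [m em] := absn_gt0 _ xs (lt0r_neq0 zx).
    have [m' em'] := absn_gt0 _ ys (ltr0_neq0 zy).
    rewrite /comb em em'; apply: positive_sumD; apply: positive_sumMn;
      exact: positive_sum_mem.
  - by rewrite zD zx zy addr0; split=> //; apply: positive_sumD.
case: (IHn s').
- move=> i v iln /s'P[[vs _]|[x [y [xs _ ys _ ->]]]].
    by apply: zint => //; exact: ltnW.
  by rewrite /comb zD !zMn rpredD// rpredM ?rpred_nat// zint// ltnW.
- move=> [f fpos]; left.
  pose g v := \sum_(i < n) f i * z i v.
  have gD v w : g (v + w) = g v + g w.
    by rewrite /g -big_split; apply: eq_bigr => i _; rewrite zD mulrDr.
  have gMn v m : g (v *+ m) = g v * m%:R.
    by rewrite /g mulr_suml; apply: eq_bigr => i _; rewrite zMn mulrA.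
  pose lower := [seq - g v / z n v | v <- s & 0 < z n v].
  pose upper := [seq g w / - z n w | w <- s & z n w < 0].
  (* The two lists are the bounds imposed on the last coefficient; they are compatible because [g]
     is positive on each [comb v w]. *)
  have [|t [lt tu]] := @exists_between lower upper.
    move=> _ _ /mapP[v + ->] /mapP[w + ->]; rewrite !mem_filter.
    move=> /andP[zv vs] /andP[zw ws].
    rewrite ltr_pdivrMr// mulrAC ltr_pdivlMr ?oppr_gt0//.
    have : 0 < g (comb v w).
      apply: fpos; rewrite mem_cat; apply/orP; right.
      by apply/allpairsP; exists (v, w); rewrite !mem_filter zv vs zw ws.
    rewrite gD !gMn !absnE ?zint//.
    by rewrite (gtr0_norm zv) (ltr0_norm zw); lra.
  exists (fun i => if i == n then t else f i) => v vs.
  rewrite big_ord_recr /= eqxx.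
  rewrite (_ : \sum_(i < n) _ = g v); last first.
    by apply: eq_bigr => i _; rewrite (ltn_eqF (ltn_ord i)).
  have [zv|zv|zv] := ltgtP (z n v) 0.
  + have vu : g v / - z n v \in upper.
      by apply/mapP; exists v; rewrite ?mem_filter ?zv.
    have := tu _ vu.
    by rewrite ltr_pdivlMr ?oppr_gt0//; lra.
  + have vl : - g v / z n v \in lower.
      by apply/mapP; exists v; rewrite ?mem_filter ?zv.
    have := lt _ vl.
    by rewrite ltr_pdivrMr//; lra.
  + rewrite zv mulr0 addr0; apply: fpos.
    by rewrite mem_cat mem_filter zv eqxx vs.
- move=> [w /sub[sw zw] zw'].
  right; exists w => // i; rewrite ltnS leq_eqVlt => /orP[/eqP ->//|].
  exact: zw'.
Qed.

End FourierMotzkin.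

(** * Finite and affine roots *)

Section Roots.
Variables (R : realType) (V : vectType R) (ip : {dot V for idfun}).
Variables (Phi Pi : seq V).
Hypothesis rootPhi : root_system ip Phi.
Hypothesis simplePi : simple_system Phi Pi.
Local Notation M := (affine_space V R).
Local Notation X := (aff_pos Phi Pi : set M).

Lemma root_neq0 a : a \in Phi -> a != 0.
Proof. by apply: contraTneq => ->; exact: rs_neq0 rootPhi. Qed.

Lemma root_dot_gt0 a : a \in Phi -> 0 < ip a a.
Proof. by move=> /root_neq0; exact: dot_gt0. Qed.

Lemma rootN a : a \in Phi -> - a \in Phi.
Proof.
move=> aP; have := rs_refl rootPhi aP aP; rewrite /refl mulfK ?gt_eqF ?root_dot_gt0//.
by rewrite scaler_nat mulr2n opprD addrA subrr sub0r.
Qed.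

Definition pairing a b := 2 * ip a b / ip b b.

Lemma pairing_int a b : a \in Phi -> b \in Phi -> pairing a b \is a Num.int.
Proof. by move=> aP bP; apply: (rs_crystallographic rootPhi). Qed.

Lemma pairing_root a b : a \in Phi -> b \in Phi -> a - pairing a b *: b \in Phi.
Proof. by move=> aP bP; apply: (rs_refl rootPhi). Qed.

Lemma pairing_lt0 a b : b \in Phi -> (pairing a b < 0) = (ip a b < 0).
Proof.
move=> bP; rewrite /pairing pmulr_llt0 ?invr_gt0 ?root_dot_gt0//.
by rewrite pmulr_rlt0.
Qed.

Lemma pairing_eq0 a b : b \in Phi -> (pairing a b == 0) = (ip a b == 0).
Proof.
move=> bP; rewrite /pairing !mulf_eq0 invr_eq0 (gt_eqF (root_dot_gt0 bP)) orbF.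
by rewrite pnatr_eq0.
Qed.

Lemma int_lt0_le (x : R) : x \is a Num.int -> x < 0 -> x = -1 \/ x <= - 2.
Proof.
move=> /intrP[m ->]; rewrite ltrz0 => m0.
have [->|m1] := eqVneq m (-1); first by left.
by right; rewrite -[- 2]/((-2)%:~R) ler_int; lia.
Qed.

(** If one of the two pairings is -1, the sum is the image of a root under a reflection. Otherwise
    both are at most -2, which forces [ip (a + b) (a + b)] to be nonpositive. *)
Lemma rootD a b : a \in Phi -> b \in Phi -> ip a b < 0 -> a + b != 0 ->
  a + b \in Phi.
Proof.
move=> aP bP ab ab0.
have ba : ip b a < 0 by rewrite dotC.
have aa := root_dot_gt0 aP; have bb := root_dot_gt0 bP.
have pab : pairing a b * ip b b = 2 * ip a b by rewrite /pairing divfK// gt_eqF.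
have pba : pairing b a * ip a a = 2 * ip a b by rewrite /pairing divfK ?gt_eqF// dotC.
have [e|le1] : pairing a b = -1 \/ pairing a b <= - 2.
- by apply: int_lt0_le; rewrite ?pairing_int ?pairing_lt0.
- by have := pairing_root aP bP; rewrite e scaleN1r opprK.
have [e|le2] : pairing b a = -1 \/ pairing b a <= - 2.
- by apply: int_lt0_le; rewrite ?pairing_int ?pairing_lt0.
- by have := pairing_root bP aP; rewrite e scaleN1r opprK addrC.
have : 0 < ip (a + b) (a + b) by apply: dot_gt0.
by rewrite !dotE (dotC ip b a); nra.
Qed.

Lemma pos_rootN a : pos_root Phi Pi a -> pos_root Phi Pi (- a) -> False.
Proof.
move=> [aP [c [c0 ea]]] [_ [d [d0 ed]]].
have [_ /andP[_ fPi] _] := simplePi.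
have := fPi; rewrite -[X in free X]/(tval (in_tuple Pi)) => /freeP fr.
have cd i : c i + d i = 0.
  apply: (fr (fun i => c i + d i)).
  rewrite (eq_bigr (fun i => c i *: Pi`_i + d i *: Pi`_i)); last first.
    by move=> j _; rewrite scalerDl.
  by rewrite big_split /= -ea -ed subrr.
have : a = 0.
  rewrite ea big1// => i _; have -> : c i = 0 by have := c0 i; have := d0 i; have := cd i; lra.
  by rewrite scale0r.
by apply/eqP/root_neq0.
Qed.

Lemma root_pos_or_neg a : a \in Phi -> pos_root Phi Pi a \/ pos_root Phi Pi (- a).
Proof. by have [_ _] := simplePi; apply. Qed.

Lemma pos_root_comb a b (c d : R) : pos_root Phi Pi a -> pos_root Phi Pi b ->
  0 <= c -> 0 <= d -> c *: a + d *: b \in Phi -> pos_root Phi Pi (c *: a + d *: b).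
Proof.
move=> [_ [x [x0 ->]]] [_ [y [y0 ->]]] c0 d0 abP; split=> //.
exists (fun i => c * x i + d * y i); split.
  by move=> i; rewrite addr_ge0// mulr_ge0.
rewrite !scaler_sumr -big_split; apply: eq_bigr => i _ /=.
by rewrite !scalerA -scalerDl.
Qed.

Lemma aff_posP (x : M) : X x <-> [/\ x.1 \in Phi, x.2 \is a Num.int &
  0 < x.2 \/ x.2 = 0 /\ pos_root Phi Pi x.1].
Proof.
case: x => a c /=; split.
  move=> [|] [b [n [pb [-> ->]]]].
    split; [by case: pb|exact: natr_int|].
    by case: n => [|n]; [right|left; rewrite ltr0n].
  split; [|exact: natr_int|by left; rewrite ltr0n].
  by case: pb => /rootN; rewrite opprK.
move=> [aP /intrP[m ->]].
rewrite ltr0z => -[m0|[/eqP m0 pa]]; last first.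
  by left; exists a, 0%N; split=> //; congr pair; apply/eqP.
have -> : m = `|m|%N.-1.+1 by lia.
case: (root_pos_or_neg aP) => pa; [left|right].
  by exists a, `|m|%N.-1.+1.
by exists a, `|m|%N.-1.
Qed.

Definition aff_root (x : M) := x.1 \in Phi /\ x.2 \is a Num.int.

Lemma aff_pos_root x : X x -> aff_root x.
Proof. by move=> /aff_posP[]. Qed.

Lemma aff_rootN x : aff_root x -> aff_root (- x).
Proof. by move=> [xP xi]; split; [exact: rootN|rewrite /= rpredN]. Qed.

Lemma aff_root_pos_or_neg x : aff_root x -> X x \/ X (- x).
Proof.
move=> [xP xi]; have [x0|x0|x0] := ltgtP x.2 0.
- right; apply/aff_posP; split=> /=; [exact: rootN|by rewrite rpredN|].
  by left; rewrite oppr_gt0.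
- by left; apply/aff_posP; split=> //; left.
- case: (root_pos_or_neg xP) => px; [left|right]; apply/aff_posP; split=> //=.
  + by right.
  + exact: rootN.
  + by rewrite rpredN.
  + by right; rewrite x0 oppr0.
Qed.

Lemma aff_posN x : X x -> X (- x) -> False.
Proof.
move=> /aff_posP[_ _ h] /aff_posP[_ _ /=].
by case: h => [h|[h px]]; case=> [h'|[h' px']]; try lra; apply: pos_rootN px px'.
Qed.

Lemma aff_pos_comb x y (a b : R) : X x -> X y -> 0 < a -> 0 < b ->
  aff_root (a *: x + b *: y) -> X (a *: x + b *: y).
Proof.
move=> /aff_posP[xP xi hx] /aff_posP[yP yi hy] a0 b0 [zP zi].
apply/aff_posP; split=> //=; rewrite /GRing.scale /=.
have pos (c d : R) : 0 < c -> 0 <= d -> 0 < a * c + b * d.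
  by move=> c0 d0; rewrite ltr_wpDr ?mulr_ge0 ?mulr_gt0// ltW.
case: hx => [hx|[hx px]].
  by left; apply: pos => //; case: hy => [/ltW|[->]].
rewrite hx mulr0 add0r; case: hy => [hy|[hy py]].
  by left; rewrite mulr_gt0.
right; split; first by rewrite hy mulr0.
by apply: pos_root_comb => //; exact: ltW.
Qed.

Lemma aff_pos_scale x y (c : R) : X x -> X y -> y = c *: x -> y = x.
Proof.
move=> Xx Xy e; have [xP _] := aff_pos_root Xx; have [yP _] := aff_pos_root Xy.
have : c *: x.1 \in Phi by rewrite -[c *: x.1]/((c *: x).1) -e.
move=> /(rs_reduced rootPhi xP)[c1|c1]; first by rewrite e c1 scale1r.
by case: (aff_posN Xx); rewrite -scaleN1r -c1 -e.
Qed.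

(** * Sign systems of biconvex sets *)

Section Signs.
Variable B : set M.
Hypothesis convB : biconvex X B.

(* The system of positive roots obtained by making exactly [B] negative. *)
Definition half x := X x /\ ~ B x \/ X (- x) /\ B (- x).

Lemma half_root x : half x -> aff_root x.
Proof. by move=> [[/aff_pos_root]|[/aff_pos_root/aff_rootN +]]//; rewrite opprK. Qed.

Lemma half_excl x : half x -> half (- x) -> False.
Proof.
move=> [[Xx Bx]|[Xx Bx]] [[Xx' Bx']|[Xx' Bx']] //.
- exact: aff_posN Xx Xx'.
- by rewrite opprK in Bx'.
- by rewrite opprK in Xx'; exact: aff_posN Xx' Xx.
Qed.

Lemma half_total x : aff_root x -> half x \/ half (- x).
Proof.
have main y : X y -> half y \/ half (- y).
  move=> Xy; have [By|By] := pselect (B y); last by left; left.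
  by right; right; rewrite opprK.
by move=> /aff_root_pos_or_neg[/main//|/main[]]; [right|left; rewrite -[x]opprK].
Qed.

(** In the mixed case, if the sum [z] had the wrong sign, then [p] would be a positive combination
    of elements of [B], or [- q] one of positive roots outside [B], against biconvexity. *)
Lemma half_comb x y (a b : R) : half x -> half y -> 0 < a -> 0 < b ->
  aff_root (a *: x + b *: y) -> half (a *: x + b *: y).
Proof.
have [BX Bc] := convB.
have mixed (p q : M) (c d : R) : X p -> ~ B p -> X (- q) -> B (- q) ->
    0 < c -> 0 < d -> aff_root (c *: p + d *: q) -> half (c *: p + d *: q).
  move=> Xp Bp Xq Bq c0 d0 zr; set z := c *: p + d *: q.
  have ic : 0 < c^-1 by rewrite invr_gt0.
  have id0 : 0 < d^-1 by rewrite invr_gt0.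
  case: (aff_root_pos_or_neg zr) => Xz; [left|right]; split=> //.
    have ep : p = c^-1 *: z + (c^-1 * d) *: - q.
      rewrite /z scalerDr !scalerA mulVf ?gt_eqF// scale1r scalerN.
      by rewrite -addrA subrr addr0.
    move=> Bz; apply: Bp; rewrite ep.
    have := Bc z (- q) c^-1 (c^-1 * d) Xz Xq ic (mulr_gt0 ic d0).
    by rewrite -ep => /(_ Xp)[+ _]; apply.
  apply: contrapT => Bz; move: Bq.
  have eq : - q = (d^-1 * c) *: p + d^-1 *: - z.
    rewrite /z scalerN scalerDr !scalerA mulVf ?gt_eqF// scale1r.
    by rewrite opprD addrA subrr sub0r.
  rewrite eq; have := Bc p (- z) (d^-1 * c) d^-1 Xp Xz (mulr_gt0 id0 c0) id0.
  by rewrite -eq => /(_ Xq)[_ +]; apply.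
move=> [[Xx Bx]|[Xx Bx]] [[Xy By]|[Xy By]] a0 b0 zr.
- left; have Xz := aff_pos_comb Xx Xy a0 b0 zr; split=> //.
  by have [_] := Bc x y a b Xx Xy a0 b0 Xz; apply.
- exact: mixed.
- by rewrite addrC in zr *; exact: mixed.
- have ez : - (a *: x + b *: y) = a *: - x + b *: - y.
    by rewrite opprD !scalerN.
  have Xz : X (a *: - x + b *: - y).
    by apply: aff_pos_comb => //; rewrite -ez; exact: aff_rootN.
  right; rewrite ez; split=> //.
  by have [+ _] := Bc (- x) (- y) a b Xx Xy a0 b0 Xz; apply.
Qed.

(* [s = 1] (resp. [s = -1]) when [delta] (resp. [- delta]) is a positive
   combination of elements of [half] lying above [a] and [- a]. *)
Definition half_type (s : R) a := a \in Phi /\ exists n m,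
  [/\ half (a, n), half (- a, m) & 0 < s * (n + m)].

Lemma half_typeN s a : half_type s a -> half_type s (- a).
Proof.
move=> [aP [n [m [hn hm nm]]]]; split; first exact: rootN.
by exists m, n; rewrite opprK addrC.
Qed.

Lemma half_type_far s a : s != 0 -> half_type s a -> exists N : R,
  forall n : R, n \is a Num.int -> N < s * n -> half (a, n) /\ half (- a, n).
Proof.
move=> s0.
have one b : half_type s b -> exists N : R,
    forall n : R, n \is a Num.int -> N < s * n -> half (b, n).
  move=> [bP [n [m [hn hm nm]]]]; exists (s * n) => k ki nk.
  have nm0 : n + m != 0 by apply: contraTneq nm => ->; rewrite mulr0 ltxx.
  (* Adding [c] copies of [(b, n) + (- b, m)], which is [n + m] times [delta], to [(b, n)] gives
     [(b, k)]. *)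
  pose c := (k - n) / (n + m).
  have c0 : 0 < c.
    have -> : c = (s * (k - n)) / (s * (n + m)).
      by rewrite -mulf_div divff ?mul1r.
    by rewrite divr_gt0// mulrBr subr_gt0.
  have e : (b, k) = (1 + c) *: ((b, n) : M) + c *: ((- b, m) : M).
    congr pair; first by rewrite /= scalerDl scale1r scalerN addrK.
    by rewrite -[RHS]/((1 + c) * n + c * m) mulrDl mul1r -addrA -mulrDr /c divfK// addrC subrK.
  rewrite e; apply: half_comb => //; first by lra.
  by rewrite -e; split.
move=> h; have [N hN] := one _ h; have [N' hN'] := one _ (half_typeN h).
exists (Num.max N N') => n ni; rewrite gt_max => /andP[h1 h2].
by split; [apply: hN|apply: hN'].
Qed.

Lemma exists_int_gt (x : R) : exists2 j : R, j \is a Num.int & x < j /\ 0 < j.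
Proof.
exists ((Num.bound `|x|).+1%:R); first exact: natr_int.
split; last by rewrite ltr0n.
apply: le_lt_trans (ler_norm x) _.
by apply: lt_trans (archi_boundP (normr_ge0 x)) _; rewrite ltr_nat.
Qed.

(* [half_comb] along the [b]-string through [a]; [n - pairing a b * m] is the
   [delta]-coordinate of the resulting root. *)
Lemma half_pairing_lt0 a b n m : half (a, n) -> half (b, m) -> pairing a b < 0 ->
  half (a - pairing a b *: b, n - pairing a b * m).
Proof.
move=> hn hm ab; have [aP ni] := half_root hn; have [bP mi] := half_root hm.
have pi := pairing_int aP bP.
have e : (a - pairing a b *: b, n - pairing a b * m) =
    1 *: ((a, n) : M) + (- pairing a b) *: ((b, m) : M).
  congr pair; first by rewrite /= scale1r scaleNr.
  by rewrite -[RHS]/(1 * n + - pairing a b * m) mul1r mulNr.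
rewrite e; apply: half_comb => //; first by rewrite oppr_gt0.
rewrite -e; split; first exact: pairing_root.
by rewrite /= rpredB// rpredM.
Qed.

Lemma half_pairing_gt0 a b n m : half (a, n) -> half (- b, m) -> 0 < pairing a b ->
  half (a - pairing a b *: b, n + pairing a b * m).
Proof.
move=> hn hm ab; have pN : pairing a (- b) = - pairing a b.
  by rewrite /pairing !dotE opprK mulrN mulNr.
have := half_pairing_lt0 hn hm; rewrite pN oppr_lt0 => /(_ ab).
by rewrite scaleNr scalerN opprK mulNr opprK.
Qed.

Definition half_full a := forall n : R, n \is a Num.int -> half (a, n).

(** The shift along [delta] caused by the reflection is absorbed by the choice of an element in the
    full string of [c]; the sign of the pairing decides which of [a] and [- a] is used. *)
Lemma half_full_refl c a n m : half_full c -> half (a, n) -> half (- a, m) ->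
  half_full (c - pairing c a *: a).
Proof.
move=> hc hn hm; have [aP ni] := half_root hn; have [_ mi] := half_root hm.
have [cP _] := half_root (hc 0 (rpred0 _)).
have pi := pairing_int cP aP.
move=> k ki; have [p0|p0|p0] := ltgtP (pairing c a) 0.
- have -> : k = (k + pairing c a * n) - pairing c a * n by rewrite addrK.
  by apply: half_pairing_lt0 => //; apply: hc; rewrite rpredD// rpredM.
- have -> : k = (k - pairing c a * m) + pairing c a * m by rewrite subrK.
  by apply: half_pairing_gt0 => //; apply: hc; rewrite rpredB// rpredM.
- by rewrite p0 scale0r subr0; apply: hc.
Qed.

Lemma half_type_orth a b : half_type 1 a -> half_type (-1) b -> ip a b = 0.
Proof.
move=> ha hb; have [aP _] := ha; have [bP _] := hb.
have pi := pairing_int aP bP.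
have [N hN] := half_type_far (oner_neq0 _) ha.
have [N' hN'] : exists N : R, forall n : R, n \is a Num.int -> N < -1 * n ->
  half (b, n) /\ half (- b, n).
- by apply: half_type_far => //; rewrite oppr_eq0 oner_eq0.
apply/eqP; rewrite -(pairing_eq0 a bP); apply/eqP.
(* Going far enough in the directions [a] and [b], the images of [a] and [- a]
   under the reflection in [b] are both in [half] with [delta]-coordinate 0. *)
have [j ji [Nj j0]] := exists_int_gt (Num.max N N').
have [Nj' N'j] : N < j /\ N' < j by move: Nj; rewrite gt_max => /andP[].
apply: contrapT => /eqP p0.
have p1 : 1 <= `|pairing a b| by rewrite norm_intr_ge1.
have ni : `|pairing a b| * j \is a Num.int 
  by rewrite rpredM//; have /intrP[q ->] := pi; rewrite -intr_norm intr_int.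
have [ha1 ha2] : half (a, `|pairing a b| * j) /\ half (- a, `|pairing a b| * j).
  by apply: hN => //; rewrite mul1r; apply: lt_le_trans Nj' _; rewrite ler_peMl// ltW.
have [hb1 hb2] : half (b, - j) /\ half (- b, - j).
  by apply: hN'; rewrite ?rpredN// mulN1r opprK.
have pN : pairing (- a) b = - pairing a b by rewrite /pairing !dotE mulrN mulNr.
have key c : c \in [:: a; - a] -> half (c - pairing c b *: b, 0).
  move=> cs; have hc : half (c, `|pairing a b| * j).
    by move: cs; rewrite !inE => /orP[] /eqP ->.
  have nc : `|pairing a b| = `|pairing c b|.
    by move: cs; rewrite !inE => /orP[] /eqP ->; rewrite ?pN ?normrN.
  have c0 : pairing c b != 0 by rewrite -normr_eq0 -nc normr_eq0.
  rewrite nc in hc; have [pc|pc|pc] := ltgtP (pairing c b) 0.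
  + have := half_pairing_lt0 hc hb1 pc.
    by rewrite (ltr0_norm pc) mulNr mulrN subrr.
  + have := half_pairing_gt0 hc hb2 pc.
    by rewrite (gtr0_norm pc) mulrN subrr.
  + by rewrite pc eqxx in c0.
apply: (half_excl (key a _)); first by rewrite inE eqxx.
have := key (- a); rewrite pN !inE eqxx orbT => /(_ isT).
by rewrite -[- (_, 0)]/(- _, - 0) oppr0 opprD scaleNr opprK.
Qed.

End Signs.

(** * Irreducibility, the sign of delta, and separating functionals *)

Hypothesis irrPhi : irreducible_roots ip Phi.
Hypothesis dimV : \dim {: V} = 2%N.

Lemma orth_decomp a b v : a != 0 -> b != 0 -> ip a b = 0 ->
  exists x y, v = x *: a + y *: b.
Proof.
move=> a0 b0 ab.
have fr : free [:: a; b].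
  rewrite free_cons span_seq1 seq1_free b0 andbT; apply: contra a0.
  move=> /vlineP[c ac]; move: ab; rewrite ac dotZl => /eqP.
  by rewrite mulf_eq0 dot_eq0 (negPf b0) orbF => /eqP ->; rewrite scale0r.
have bs : basis_of fullv [:: a; b] by rewrite basisEfree fr subvf dimV.
have : v \in <<[:: a; b]>>%VS by rewrite (span_basis bs) memvf.
rewrite span_cons span_seq1 => /memv_addP[_ /vlineP[x ->]] [_ /vlineP[y ->] ->].
by exists x, y.
Qed.

(** Otherwise every root is orthogonal to [a] or to [b], hence in rank two proportional to [b] or to
    [a], and the root system splits. *)
Lemma nonorth_root a b : a \in Phi -> b \in Phi -> ip a b = 0 ->
  exists2 c, c \in Phi & ip c a != 0 /\ ip c b != 0.
Proof.
move=> aP bP ab; apply: contrapT => none.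
have [a0 b0] := (root_neq0 aP, root_neq0 bP).
have [_ /(_ [set x | x \in Phi /\ ip x b = 0] [set x | x \in Phi /\ ip x b != 0])] := irrPhi.
case.
- by exists a.
- by exists b; split=> //; rewrite dot_eq0.
- by apply/seteqP; split=> [x [[_ /= xb] [_ /=]]|x []]; rewrite ?xb ?eqxx.
- apply/seteqP; split=> [x [[]|[]]//|x /= xP].
  by have [xb|xb] := eqVneq (ip x b) 0; [left|right].
move=> c [d [[/= cP cb] [/= dP db]]] /eqP; apply.
have da : ip d a = 0.
  by apply/eqP; apply: contraT => da; case: none; exists d.
have [x [y e]] := orth_decomp c a0 b0 ab.
have y0 : y = 0.
  move: cb; rewrite e !dotE ab mulr0 add0r => /eqP.
  by rewrite mulf_eq0 dot_eq0 (negPf b0) orbF => /eqP.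
by rewrite e y0 scale0r addr0 dotZl dotC da mulr0.
Qed.

(** Let [c] be a root orthogonal to neither [a] nor [b]. Having no type of its own by
    [half_type_orth], [c] or [- c] has its full string in [half B]. Reflecting this string in the
    orthogonal roots [b] and [a] gives the full string of the opposite root, a contradiction. *)
Lemma half_type_excl (B : set M) a b : biconvex X B ->
  half_type B 1 a -> half_type B (-1) b -> False.
Proof.
move=> cB ha hb; have [aP [na [ma [hna hma nma]]]] := ha.
have [bP [nb [mb [hnb hmb nmb]]]] := hb.
have ab := half_type_orth cB ha hb.
have [c cP [ca cb]] := nonorth_root aP bP ab.
have nfull d : d \in Phi -> ip d a != 0 -> ip d b != 0 ->
    (forall n, half B (d, n) -> forall m, half B (- d, m) -> False).
  move=> dP da db n hn m hm; have [nm|nm|nm] := ltgtP (n + m) 0.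
  - have hd : half_type B (-1) d.
      by split=> //; exists n, m; rewrite mulN1r oppr_gt0.
    by move: da; rewrite dotC (half_type_orth cB ha hd) eqxx.
  - have hd : half_type B 1 d by split=> //; exists n, m; rewrite mul1r.
    by move: db; rewrite (half_type_orth cB hd hb) eqxx.
  - apply: (half_excl hn); rewrite -[- (_, _)]/(- d, - n).
    by have -> : - n = m by lra.
have main d : d \in Phi -> half_full B d -> False.
  move=> dP hd; have [x [y e]] := orth_decomp d (root_neq0 aP) (root_neq0 bP) ab.
  have [aa bb] := (root_dot_gt0 aP, root_dot_gt0 bP).
  have := half_full_refl cB (half_full_refl cB hd hnb hmb) hna hma.
  have -> : d - pairing d b *: b = x *: a - y *: b.
    rewrite /pairing e !dotE ab mulr0 add0r mulrA mulfK ?gt_eqF//.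
    by rewrite mulrDl mul1r scalerDl opprD addrA addrK.
  have -> : pairing (x *: a - y *: b) a = 2 * x.
    by rewrite /pairing !dotE (dotC ip b a) ab mulr0 subr0 mulrA mulfK ?gt_eqF.
  have -> : x *: a - y *: b - (2 * x) *: a = - d.
    by rewrite e mulrDl mul1r scalerDl !opprD addrACA subrr add0r addrC.
  move=> hd'; apply: (half_excl (hd 0 (rpred0 _))).
  by have := hd' 0 (rpred0 _); rewrite -[- (_, _)]/(- d, - 0) oppr0.
have int_root d n : d \in Phi -> n \is a Num.int -> aff_root (d, n) by [].
have [[m hm]|nh] := pselect (exists m, half B (- c, m)).
  apply: (main (- c) (rootN cP)) => n ni.
  case: (half_total B (int_root _ _ (rootN cP) ni)) => //.
  rewrite -[- (_, _)]/(- - c, - n) opprK => hc.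
  by case: (nfull c cP ca cb _ hc _ hm).
apply: (main c cP) => n ni.
case: (half_total B (int_root _ _ cP ni)) => // hc.
by case: nh; exists (- n).
Qed.

(* Two summands with negative inner product are replaced by their sum, which is
   in [half] or is a positive multiple of delta = (0, 1). *)
Lemma half_sum_neq0 (B : set M) (s : seq M) (t : R) : biconvex X B ->
  (forall a n m, half B (a, n) -> half B (- a, m) -> 0 < n + m) ->
  (forall x, x \in s -> half B x) -> 0 <= t -> s != [::] \/ 0 < t ->
  \sum_(x <- s) x + (0, t) <> 0.
Proof.
move=> cB pos; have [k] := ubnP (size s); elim: k s t => [//|k IHk] s t.
case: s => [_ _ t0|x s].
  rewrite big_nil add0r eqxx => -[//|t0'] [t1].
  by rewrite t1 ltxx in t0'.
rewrite /= ltnS => sk hs t0 _ e.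
have hx : half B x by apply: hs; rewrite inE eqxx.
have [xP xi] := half_root hx.
have e1 : x.1 + \sum_(y <- s) y.1 = 0.
  have /(congr1 (fun v : M => v.1)) := e.
  rewrite big_cons /= addr0 (_ : (\sum_(y <- s) y).1 = \sum_(y <- s) y.1)//.
  by elim/big_rec2: _ => // y u v _ <-.
have [y ys xy] : exists2 y, y \in s & ip x.1 y.1 < 0.
  apply: contrapT => none.
  have : 0 < ip (x.1 + \sum_(y <- s) y.1) x.1.
    rewrite dotDl ltr_wpDr ?root_dot_gt0// dot_suml big_seq sumr_ge0// => y ys.
    by rewrite dotC leNgt; apply/negP => xy; apply: none; exists y.
  by rewrite e1 dot0l ltxx.
have hy : half B y by apply: hs; rewrite inE ys orbT.
have [yP yi] := half_root hy.
have hrem z : z \in rem y s -> half B z.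
  by move=> /mem_rem zs; apply: hs; rewrite inE zs orbT.
have srem : size (rem y s) = (size s).-1 by rewrite size_rem.
have s0 : (0 < size s)%N by case: (s) ys.
have esum : \sum_(z <- s) z = y + \sum_(z <- rem y s) z.
  by rewrite (perm_big _ (perm_to_rem ys)) big_cons.
have [xy0|xy0] := eqVneq (x.1 + y.1) 0.
- have yx : y.1 = - x.1 by apply/eqP; rewrite -addr_eq0 addrC xy0.
  have lt0 : 0 < x.2 + y.2.
    by apply: (pos x.1); [case: (x) hx|rewrite -yx; case: (y) hy].
  apply: (IHk (rem y s) (t + (x.2 + y.2))) => //; first by rewrite srem; lia.
  + by rewrite addr_ge0// ltW.
  + by right; rewrite ltr_wpDl.
  + rewrite -[RHS]e big_cons esum.
    have -> : ((0, t + (x.2 + y.2)) : M) = x + y + (0, t).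
      by congr pair; rewrite /= ?xy0 ?addr0// addrC.
    by rewrite addrA (addrC (\sum_(z <- _) z)) !addrA.
- have xyP := rootD xP yP xy xy0.
  have hxy : half B (x + y).
    have := @half_comb B cB x y 1 1 hx hy; rewrite !scale1r; apply=> //.
    by split=> //=; rewrite rpredD.
  apply: (IHk (x + y :: rem y s) t) => //=.
  + by rewrite srem; lia.
  + by move=> z; rewrite inE => /orP[/eqP ->|/hrem].
  + by left.
  + by rewrite -[RHS]e !big_cons esum !addrA.
Qed.

(** A functional positive on [delta] and on the lowest root outside [B] in each string is positive
    at every root outside [B]. *)
Lemma aff_pos_minimal (B : set M) (l : seq V) : exists Q : seq M,
  (forall q, q \in Q -> X q /\ ~ B q) /\
  forall x, X x -> ~ B x -> x.1 \in l ->
    exists2 q, q \in Q & x.1 = q.1 /\ q.2 <= x.2.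
Proof.
elim: l => [|a l [Q [QB Qmin]]]; first by exists [::].
have [[n0 hn0]|nh] := pselect (exists n : nat, X (a, n%:R) /\ ~ B (a, n%:R)).
  have ex : exists n : nat, `[< X (a, n%:R) /\ ~ B (a, n%:R) >].
    by exists n0; apply/asboolP.
  case: (ex_minnP ex) => n /asboolP hn nmin.
  exists ((a, n%:R) :: Q); split.
    by move=> q; rewrite inE => /orP[/eqP ->//|/QB].
  move=> [b c] Xx Bx /=; rewrite inE => /orP[/eqP ba|bl]; last first.
    by have [q qQ h] := Qmin _ Xx Bx bl; exists q => //; rewrite inE qQ orbT.
  exists (a, n%:R); first by rewrite inE eqxx.
  split=> //=; have [_ /= ci c0] := (aff_posP _).1 Xx.
  have cn : c \is a Num.nat.
    by rewrite natrEint ci; case: c0 => [/ltW|[-> _]]; rewrite ?lexx.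
  have /natrP[m em] := cn; rewrite em ler_nat; apply: nmin.
  by apply/asboolP; rewrite -em -ba.
exists Q; split=> // -[b c] Xx Bx /=; rewrite inE => /orP[/eqP ba|bl]; last first.
  exact: (Qmin (b, c)).
case: nh; have [_ /= ci c0] := (aff_posP _).1 Xx.
have cn : c \is a Num.nat.
  by rewrite natrEint ci; case: c0 => [/ltW|[-> _]]; rewrite ?lexx.
by have /natrP[m em] := cn; exists m; rewrite -em -ba.
Qed.

(** Gordan's theorem is applied to [delta], the lowest roots outside [B] and the negatives of [F].
    Its alternative is a vanishing sum, excluded by [half_sum_neq0]. *)
Lemma separation (B : set M) (F : seq M) : biconvex X B ->
  (forall a n m, half B (a, n) -> half B (- a, m) -> 0 < n + m) ->
  (forall x, x \in F -> B x) ->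
  exists f : M, [/\ 0 < f.2, forall x, X x -> ~ B x -> 0 < aff_dot ip f x &
    forall x, x \in F -> aff_dot ip f x < 0].
Proof.
move=> cB pos FB; have [BX _] := cB.
have [Q [QB Qmin]] := aff_pos_minimal B Phi.
have [sPi /andP[/eqP spanPi _] _] := simplePi.
pose n := size Pi.
(* The coordinates are the Cartan pairings with the simple roots, followed by the
   [delta]-coefficient at index [n]. They are integral on roots and vanish jointly only at [0], as
   [Pi] spans. *)
pose z i (v : M) : R := if (i < n)%N then pairing v.1 Pi`_i else v.2.
have zD i : {morph z i : u v / u + v}.
  by move=> u v; rewrite /z; case: ifP => //= _; rewrite /pairing dotDl mulrDr mulrDl.
have PiP i : (i < n)%N -> Pi`_i \in Phi by move=> ni; apply/sPi/mem_nth.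
pose s : seq M := (0, 1) :: Q ++ map -%R F.
have sP x : x \in s -> x = (0, 1) \/ half B x.
  rewrite inE mem_cat => /or3P[/eqP ->|/QB xQ|/mapP[y yF ->]]; first by left.
    by right; left.
  by right; right; rewrite opprK; split; [apply/BX|]; exact: FB.
have zint i v : (i < n.+1)%N -> v \in s -> z i v \is a Num.int.
  move=> _ /sP[->|/half_root[vP vi]]; rewrite /z; case: ifP => //= ni.
    by rewrite /pairing dot0l mulr0 mul0r rpred0.
  exact: pairing_int (PiP _ ni).
case: (integral_gordan zD zint) => [[f fpos]|[w sw zw]]; last first.
  have w0 : w = 0.
    have w2 : w.2 = 0 by have := zw n (ltnSn n); rewrite /z ltnn.
    suff w1 : w.1 = 0 by case: (w) w1 w2 => a c /= -> ->.
    apply/eqP; rewrite -(dot_eq0 ip); apply/eqP.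
    have : w.1 \in <<Pi>>%VS by rewrite spanPi memvf.
    rewrite -[X in <<X>>%VS]/(tval (in_tuple Pi)) => /coord_span {1}->.
    rewrite dot_suml big1// => i _; rewrite dotZl dotC.
    have := zw i (ltnW (ltn_ord i)); rewrite /z ltn_ord => /eqP.
    by rewrite pairing_eq0 ?PiP// => /eqP ->; rewrite mulr0.
  have [l [t [lB t0 lt ew]]] : exists (l : seq M) (t : R),
      [/\ forall x, x \in l -> half B x, 0 <= t, l != [::] \/ 0 < t &
        w = \sum_(x <- l) x + (0, t)].
    elim: sw {w0 zw} => [v /sP[->|hv]|
      v v' _ [l [t [lB t0 lt ->]]] _ [l' [t' [lB' t0' lt' ->]]]].
    - by exists [::], 1; rewrite big_nil add0r; split=> //; right.
    - exists [:: v], 0; rewrite big_seq1 addr0; split=> //; last by left.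
      by move=> x; rewrite inE => /eqP ->.
    - exists (l ++ l'), (t + t'); split.
      + by move=> x; rewrite mem_cat => /orP[/lB|/lB'].
      + exact: addr_ge0.
      + case: lt => lt; last by right; rewrite ltr_wpDr.
        by left; case: (l) lt.
      + rewrite big_cat /= addrACA; congr (_ + _).
        by congr pair; rewrite /= addr0.
  by have := half_sum_neq0 cB pos lB t0 lt; rewrite -ew w0.
pose g : M := (\sum_(i < n) (f i * (2 / ip Pi`_i Pi`_i)) *: Pi`_i, f n).
have gE x : aff_dot ip g x = \sum_(i < n.+1) f i * z i x.
  rewrite /aff_dot big_ord_recr /= {2}/z ltnn dot_suml; congr (_ + _).
  apply: eq_bigr => i _; rewrite /z ltn_ord /pairing dotZl dotC.
  by rewrite -!mulrA (mulrC (ip _ _)) !mulrA.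
have gs x : x \in s -> 0 < aff_dot ip g x by move=> /fpos; rewrite -gE.
have gd : 0 < g.2.
  by have := gs (0, 1); rewrite inE eqxx /aff_dot dot0r add0r mulr1; apply.
exists g; split=> //.
- move=> x Xx Bx; have [xP _] := aff_pos_root Xx.
  have [q qQ [e q2]] := Qmin _ Xx Bx xP.
  have : 0 < aff_dot ip g q by apply: gs; rewrite inE mem_cat qQ orbT.
  rewrite /aff_dot e => /lt_le_trans; apply; rewrite lerD2l ler_pM2l//.
- move=> x xF; have : 0 < aff_dot ip g (- x).
    by apply: gs; rewrite inE mem_cat map_f ?orbT.
  by rewrite dotNr oppr_gt0.
Qed.

Lemma negative_finite (f : M) : 0 < f.2 ->
  exists Z : seq M, forall x, X x -> aff_dot ip f x <= 0 -> x \in Z.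
Proof.
move=> f0; have [K KP] : exists K : V -> nat, forall a, `|ip a f.1| / f.2 < (K a)%:R.
  exists (fun a => Num.bound (`|ip a f.1| / f.2)) => a.
  by apply: archi_boundP; rewrite divr_ge0 ?normr_ge0// ltW.
exists (flatten [seq [seq ((a, n%:R) : M) | n <- iota 0 (K a)] | a <- Phi]).
move=> [a c] Xx fx.
have [/= aP ci c0] := (aff_posP _).1 Xx.
have cn : c \is a Num.nat.
  by rewrite natrEint ci; case: c0 => [/ltW|[-> _]]; rewrite ?lexx.
have /natrP[n en] := cn.
apply/flatten_mapP; exists a => //; apply/mapP; exists n; last by rewrite en.
rewrite mem_iota add0n leq0n /= -(ltr_nat R) -en.
apply: le_lt_trans (KP a); rewrite ler_pdivlMr// -normrN; apply: le_trans (ler_norm _).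
by move: fx; rewrite /aff_dot /= dotC (mulrC f.2); lra.
Qed.

(** The functionals are chosen in turn. The previous one is nonpositive at finitely many roots only,
    all in the next section; adding these to the finite set on which the next functional is negative
    gives [above]. *)
Lemma separation_chain m (B : nat -> set M) (F : nat -> seq M) :
  (forall i, (i < m)%N -> biconvex X (B i)) ->
  (forall i, (i.+1 < m)%N -> B i `<=` B i.+1) ->
  (forall i, (i < m)%N ->
    forall a n k, half (B i) (a, n) -> half (B i) (- a, k) -> 0 < n + k) ->
  (forall i, (i < m)%N -> forall x, x \in F i -> B i x) ->
  exists f : nat -> M, (forall i, (i < m)%N -> [/\ 0 < (f i).2,
      forall x, X x -> ~ B i x -> 0 < aff_dot ip (f i) x &
      forall x, x \in F i -> aff_dot ip (f i) x < 0]) /\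
    (forall i, (i.+1 < m)%N -> above (aff_dot ip) X (f i) (f i.+1)).
Proof.
elim: m => [|m IHm] convB incB posB FB; first by exists (fun=> 0).
have [f [fsep fab]] : exists f : nat -> M, (forall i, (i < m)%N -> [/\ 0 < (f i).2,
      forall x, X x -> ~ B i x -> 0 < aff_dot ip (f i) x &
      forall x, x \in F i -> aff_dot ip (f i) x < 0]) /\
    (forall i, (i.+1 < m)%N -> above (aff_dot ip) X (f i) (f i.+1)).
  apply: IHm => i im; [apply: convB|apply: incB|apply: posB|apply: FB];
    exact: leqW.
have [Z Zin Zout] : exists2 Z : seq M, forall x, x \in Z -> B m x &
    forall x i, m = i.+1 -> X x -> aff_dot ip (f i) x <= 0 -> x \in Z.
  case: m convB incB posB FB f fsep fab {IHm} => [|m] convB incB posB FB f fsep fab.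
    by exists [::].
  have [f0 fpos _] := fsep m (ltnSn m).
  have [Z ZP] := negative_finite f0.
  exists [seq x <- Z | `[< X x /\ aff_dot ip (f m) x <= 0 >]].
    move=> x; rewrite mem_filter => /andP[/asboolP[Xx fx] _].
    apply: (incB m) => //; apply: contrapT => /(fpos _ Xx).
    by rewrite ltNge fx.
  move=> x i [<-] Xx fx; rewrite mem_filter ZP// andbT.
  by apply/asboolP.
have [g [g0 gpos gneg]] : exists f : M, [/\ 0 < f.2,
    forall x, X x -> ~ B m x -> 0 < aff_dot ip f x &
    forall x, x \in F m ++ Z -> aff_dot ip f x < 0].
  apply: separation (convB m (ltnSn m)) (posB m (ltnSn m)) _.
  by move=> x; rewrite mem_cat => /orP[/(FB m (ltnSn m))|/Zin].
exists (fun i => if i == m then g else f i); split=> i.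
  rewrite ltnS leq_eqVlt; have [-> _|_ /=] := eqVneq i m; last exact: fsep.
  by split=> // x xF; apply: gneg; rewrite mem_cat xF.
rewrite ltnS => im; rewrite (ltn_eqF im).
have [im'|im'] := eqVneq i.+1 m; last by apply: fab; rewrite ltn_neqAle im' im.
by move=> x Xx fx; apply: gneg; rewrite mem_cat (Zout x i)// orbT.
Qed.

Lemma biconvexC (B : set M) : biconvex X B -> biconvex X (X `\` B).
Proof.
move=> [BX Bc]; split; first by move=> x [].
move=> x y a b Xx Xy a0 b0 Xz; have [cc nn] := Bc x y a b Xx Xy a0 b0 Xz.
split=> [[_ Bx] [_ By]|nBx nBy [_ Bz]]; first by split=> //; apply: nn.
apply: Bz; apply: cc; apply: contrapT => h; [exact: nBx|exact: nBy].
Qed.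

Lemma halfC (B : set M) x : B `<=` X -> half (X `\` B) x -> half B (- x).
Proof.
move=> BX [[Xx nB]|[Xx [_ Bx]]]; [right|by left].
by rewrite opprK; split=> //; apply: contrapT => Bx; apply: nB.
Qed.

(** * Initial sections of a reflection order *)

Section Initial.
Variables (prec : M -> M -> Prop) (ro : reflection_order Phi Pi prec).

Definition initial (e : M) : set M := [set x | X x /\ (prec x e \/ x = e)].

Lemma not_initial e x : X e -> X x -> ~ initial e x -> prec e x.
Proof.
move=> Xe Xx nx; have xe : e <> x by move=> xe; apply: nx; split=> //; right.
by case: (ro_total ro Xe Xx xe) => // xe'; case: nx; split=> //; left.
Qed.

Lemma prec_not_initial e x : X e -> prec e x -> ~ initial e x.
Proof.
move=> Xe ex [Xx [xe|xe]]; last by rewrite xe in ex; exact: (ro_irr ro Xe).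
exact: (ro_irr ro Xe (ro_trans ro Xe Xx Xe ex xe)).
Qed.

Lemma initial_biconvex e : X e -> biconvex X (initial e).
Proof.
move=> Xe; split; first by move=> x [].
have main x y a b : X x -> X y -> 0 < a -> 0 < b -> X (a *: x + b *: y) ->
    prec x y -> (initial e y -> initial e (a *: x + b *: y)) /\
    (~ initial e x -> ~ initial e (a *: x + b *: y)).
  move=> Xx Xy a0 b0 Xz xy; have [xz zy] := ro_convex ro Xx Xy xy a0 b0 Xz.
  split=> [[_ [ye|<-]]|/(not_initial Xe Xx) ex].
  - by split=> //; left; apply: (ro_trans ro Xz Xy Xe).
  - by split=> //; left.
  - by apply: prec_not_initial => //; apply: (ro_trans ro Xe Xx Xz).
move=> x y a b Xx Xy a0 b0 Xz.
have [xy|/eqP xy] := eqVneq x y.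
  have e1 : a *: x + b *: y = x.
    apply: (aff_pos_scale Xx Xz (c := a + b)).
    by rewrite -xy scalerDl.
  by rewrite e1; split.
case: (ro_total ro Xx Xy xy) => h.
  by have [h1 h2] := main x y a b Xx Xy a0 b0 Xz h; split=> [_|nx _]; [exact: h1|exact: h2].
rewrite addrC in Xz *.
by have [h1 h2] := main y x b a Xy Xx b0 a0 Xz h; split=> [Bx _|_]; [exact: h1|exact: h2].
Qed.

Lemma initial_sub e e' : X e -> X e' -> prec e e' -> initial e `<=` initial e'.
Proof.
move=> Xe Xe' ee' x [Xx [xe|->]]; split=> //; left => //.
exact: (ro_trans ro Xx Xe Xe').
Qed.

(** As long as [- delta] is not on the positive side, [separation] applies to the section itself.
    Afterwards it applies to the complement, whose sign system is the opposite one, and the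
    functional is negated. *)
Lemma order_separated (s : seq M) : (forall x, x \in s -> X x) ->
  (forall i j, (i < j < size s)%N -> prec s`_i s`_j) ->
  separated (aff_dot ip) X s.
Proof.
move=> sX sprec.
have Xs i : (i < size s)%N -> X s`_i by move=> iss; apply/sX/mem_nth.
pose B i := initial s`_i.
have cB i : (i < size s)%N -> biconvex X (B i) by move=> /Xs; exact: initial_biconvex.
have incB i j : (i <= j)%N -> (j < size s)%N -> B i `<=` B j.
  rewrite leq_eqVlt => /orP[/eqP -> _ x //|ij js].
  rewrite /B; apply: initial_sub; [apply: Xs; lia|exact: Xs|].
  by apply: sprec; rewrite ij.
have Bin i j : (i < size s)%N -> (j <= i)%N -> B i s`_j.
  move=> iss ji; apply: (incB j) => //; split; last by right.
  by apply: Xs; lia.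
have Bout i j : (j < size s)%N -> (i < j)%N -> ~ B i s`_j.
  move=> js ij; apply: prec_not_initial; first by apply: Xs; lia.
  by apply: sprec; rewrite ij.
pose up i := exists a, half_type (B i) (-1) a.
(* Far down a string, the elements of [half (B i)] are negatives of elements of [B i]; they stay in
   [half (B j)] for the larger section. *)
have up_mono i j : (i <= j)%N -> (j < size s)%N -> up i -> up j.
  move=> ij js [a ha]; exists a; have [aP _] := ha; split=> //.
  have [N hN] : exists N : R, forall n : R, n \is a Num.int -> N < -1 * n ->
      half (B i) (a, n) /\ half (B i) (- a, n).
    by apply: half_type_far; [apply: cB; lia|rewrite oppr_eq0 oner_eq0|].
  have [n ni [Nn n0]] := exists_int_gt N.
  have [h1 h2] : half (B i) (a, - n) /\ half (B i) (- a, - n).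
    by apply: hN; rewrite ?rpredN// mulN1r opprK.
  have neg b : half (B i) (b, - n) -> half (B j) (b, - n).
    move=> [[/aff_posP[_ _ /=]]|[Xb Bb]]; first by case; lra.
    by right; split=> //; apply: (incB i j).
  exists (- n), (- n); split; [exact: neg|exact: neg|].
  by rewrite mulN1r; lra.
have down_pos i : (i < size s)%N -> ~ up i -> forall a n k,
    half (B i) (a, n) -> half (B i) (- a, k) -> 0 < n + k.
  move=> iss nup a n k hn hk; have [aP _] := half_root hn.
  have [nk|//|nk] := ltgtP (n + k) 0.
    by case: nup; exists a; split=> //; exists n, k; rewrite mulN1r oppr_gt0.
  case: (half_excl hn); rewrite -[- (_, _)]/(- a, - n).
  by have -> : - n = k by lra.
have up_pos i : (i < size s)%N -> up i -> forall a n k,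
    half (X `\` B i) (a, n) -> half (X `\` B i) (- a, k) -> 0 < n + k.
  move=> iss [b hb] a n k.
  have BX : B i `<=` X by have [] := cB i iss.
  move=> /(halfC BX) hn /(halfC BX) hk; have [aP _] := half_root hk.
  rewrite -[- (_, _)]/(- a, - n) in hn; rewrite -[- (_, _)]/(- - a, - k) opprK in hk aP.
  have [nk|//|nk] := ltgtP (n + k) 0.
    case: (half_type_excl (cB i iss) _ hb (a := a)); split=> //.
    by exists (- k), (- n); rewrite mul1r; split=> //; lra.
  case: (half_excl hk); rewrite -[- (_, _)]/(- a, - - k) opprK.
  by have -> : k = - n by lra.
(* There are [N] cuts between consecutive elements of [s]; [m] will be the first one at which [up]
   holds, or [N] if there is none. *)
pose N := (size s).-1.
have Ns i : (i < N)%N -> (i.+1 < size s)%N by rewrite /N; lia.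
have [m [mN mdown mup]] : exists m, [/\ (m <= N)%N,
    forall i, (i < m)%N -> ~ up i & forall i, (m <= i)%N -> (i < N)%N -> up i].
  have [ex|nex] := pselect (exists i, (i < N)%N && `[< up i >]); last first.
    exists N; split=> // i iN; last by move=> h; lia.
    by move=> ui; apply: nex; exists i; rewrite iN; apply/asboolP.
  case: (ex_minnP ex) => m /andP[mN /asboolP um] mmin.
  exists m; split; first exact: ltnW.
    move=> i im ui; have := mmin i; rewrite [(m <= i)%N]leqNgt im => h.
    by have /h : (i < N)%N && `[< up i >] by rewrite (ltn_trans im mN); exact/asboolP.
  by move=> i mi iN; apply: up_mono mi _ um; exact/ltnW/Ns.
have take_B i x : (i < size s)%N -> x \in take i.+1 s -> B i x.
  move=> iss /(nthP 0)[j]; rewrite size_takel// ltnS => ji <-.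
  by rewrite nth_take ?ltnS//; apply: Bin.
have drop_B i x : (i < size s)%N -> x \in drop i.+1 s -> (X `\` B i) x.
  move=> iss /(nthP 0)[j]; rewrite size_drop => js <-; rewrite nth_drop.
  rewrite ltn_subRL in js; split; first exact: Xs.
  by apply: Bout => //; exact: leq_addr.
have [f [fsep fab]] : exists f : nat -> M, (forall i, (i < m)%N -> [/\ 0 < (f i).2,
      forall x, X x -> ~ B i x -> 0 < aff_dot ip (f i) x &
      forall x, x \in take i.+1 s -> aff_dot ip (f i) x < 0]) /\
    (forall i, (i.+1 < m)%N -> above (aff_dot ip) X (f i) (f i.+1)).
  apply: separation_chain => i im; have iN := leq_trans im mN.
  - exact/cB/ltnW/Ns.
  - by apply: incB => //; apply/ltnW/Ns.
  - by apply: down_pos; [exact/ltnW/Ns|exact: mdown].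
  - by move=> x; apply: take_B; exact/ltnW/Ns.
(* Complements shrink as the cut advances, so this chain is built backwards: its entry [i] belongs
   to the cut [N - i.+1]. *)
have [g [gsep gab]] : exists f : nat -> M, (forall i, (i < N - m)%N -> [/\ 0 < (f i).2,
      forall x, X x -> ~ (X `\` B (N - i.+1)%N) x -> 0 < aff_dot ip (f i) x &
      forall x, x \in drop (N - i.+1).+1 s -> aff_dot ip (f i) x < 0]) /\
    (forall i, (i.+1 < N - m)%N -> above (aff_dot ip) X (f i) (f i.+1)).
  apply: separation_chain => i im; have iN : (N - i.+1 < N)%N by lia.
  - exact/biconvexC/cB/ltnW/Ns.
  - move=> x [Xx Bx]; split=> // Bx'; apply: Bx; move: Bx'.
    by apply: incB; [lia|exact/ltnW/Ns].
  - by apply: up_pos; [exact/ltnW/Ns|apply: mup => //; lia].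
  - by move=> x; apply: drop_B; exact/ltnW/Ns.
pose F i := if (i < m)%N then f i else - g (N - i.+1)%N.
have revi i : (i < N)%N -> (N - (N - i.+1).+1)%N = i by lia.
have BX i x : B i x -> X x by case.
exists F; split=> [i j iss js|i iss]; rewrite /F; last first.
  have [im|im] := ltnP i.+1 m; first by rewrite (ltnW im); apply: fab.
  have iN : (i.+1 < N)%N by rewrite /N -ltnS (ltn_predK iss).
  have iN' := ltnW iN.
  have h1 : (N - i.+2 < N - m)%N by lia.
  have [_ gpos _] := gsep _ h1; rewrite (revi _ iN) in gpos.
  case: ltnP => im' x Xx; rewrite !dotNl ?oppr_le0 oppr_lt0 => fx.
    (* At the switch, a root nonpositive at [f i] lies in [B i], hence in [B i.+1], where the
       negated functional is negative. *)
    have [_ fpos _] := fsep i im'.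
    apply: gpos => // -[_]; apply; apply: (incB i); [by []|exact: ltnW|].
    by apply: contrapT => /(fpos _ Xx); rewrite ltNge fx.
  have h2 : ((N - i.+2).+1 < N - m)%N by lia.
  have := gab _ h2 x Xx; rewrite (_ : (N - i.+2).+1 = N - i.+1)%N; last by lia.
  move=> h; rewrite ltNge; apply/negP => /h; by rewrite ltNge fx.
have iN : (i < N)%N by rewrite /N -ltnS (ltn_predK iss).
have jin : (j <= i)%N -> s`_j \in take i.+1 s.
  move=> ji; rewrite -(nth_take 0 (n0 := i.+1)) ?ltnS// mem_nth// size_takel ?ltnS//.
  exact: ltnW.
have jout : (i < j)%N -> s`_j \in drop i.+1 s.
  move=> ij; rewrite -(subnKC ij) -nth_drop mem_nth// size_drop.
  by apply: ltn_sub2r => //; exact: leq_ltn_trans ij js.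
have Xj := Xs _ js.
case: ltnP => im; have [ji|ij] := leqP j i.
- by have [_ _ ->] := fsep i im; rewrite ?jin.
- have [_ h _] := fsep i im; apply/negbTE; rewrite -leNgt ltW// h//.
  exact: Bout.
- have h1 : (N - i.+1 < N - m)%N by lia.
  have [_ gpos _] := gsep _ h1; rewrite (revi _ iN) in gpos.
  by rewrite dotNl oppr_lt0 gpos// => -[_]; apply; apply: Bin => //; lia.
- have h1 : (N - i.+1 < N - m)%N by lia.
  have [_ _ gneg] := gsep _ h1; rewrite (revi _ iN) in gneg.
  by rewrite dotNl oppr_lt0 ltNge (ltW (gneg _ (jout ij))).
Qed.

End Initial.

(** * Maximal dihedral subgroups and planes *)

Local Notation ev := (aff_dot ip).

(** Separation for the empty section, whose sign system consists of positive roots only. *)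
Lemma exists_positive : exists2 f : M, 0 < f.2 & forall x, X x -> 0 < ev f x.
Proof.
have half0 x : half set0 x -> X x by case=> [[]|[]].
have [||//|f [f0 fpos _]] := @separation set0 [::].
- by split=> // x y a b _ _ _ _ _; split.
- move=> a n m /half0/aff_posP[_ _ /= hn] /half0/aff_posP[_ _ /= hm].
  case: hn => [hn|[-> pa]]; case: hm => [hm|[-> pNa]]; try lra.
  by case: (pos_rootN pa pNa).
- by exists f => // x Xx; apply: fpos.
Qed.

Lemma dim_affine : \dim {: M} = 3%N.
Proof.
have := dimV; rewrite !dimvf => dV.
by rewrite -[LHS]/(vector.dim V + 1)%N dV.
Qed.

Let X_red x y c (Xx : X x) (Xy : X y) (e : y = c *: x) : y = x :=
  aff_pos_scale Xx Xy e.

Lemma plane_roots p x y : p != 0 -> X x -> X y -> x != y ->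
  ev p x = 0 -> ev p y = 0 ->
  exists a b, [/\ X a, X b, a != b, ev p a = 0 /\ ev p b = 0 &
    forall z, X z -> ev p z = 0 ->
      exists c d, [/\ 0 <= c, 0 <= d & z = c *: a + d *: b]].
Proof.
move=> p0 Xx Xy xy px py.
have [p2|p2] := eqVneq p.2 0; last first.
  (* A plane not containing [delta] meets each string at most once, so its roots form a finite list
     and have extreme elements. *)
  pose s := [seq z <- [seq ((a, - ip p.1 a / p.2) : M) | a <- Phi] | `[< X z >]].
  have sP z : (z \in s) <-> X z /\ ev p z = 0.
    rewrite mem_filter; split=> [/andP[/asboolP Xz /mapP[a aP e]]|[Xz pz]].
      by split=> //; rewrite e /aff_dot /= mulrC divfK// subrr.
    apply/andP; split; first exact/asboolP.
    have [zP _] := aff_pos_root Xz; apply/mapP; exists z.1 => //.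
    case: z pz zP {Xz} => a c /= pz _; congr pair.
    move: pz; rewrite /aff_dot /= => pz.
    have -> : - ip p.1 a = c * p.2 by lra.
    by rewrite mulfK.
  have [f _ fX] := exists_positive.
  have [a [b [as_ bs ab cone]]] := extreme_roots dim_affine fX X_red p0
    (fun z => (sP z).1) ((sP x).2 (conj Xx px)) ((sP y).2 (conj Xy py)) xy.
  have [Xa pa] := (sP a).1 as_; have [Xb pb] := (sP b).1 bs.
  by exists a, b; split=> // z Xz pz; apply/cone/sP.
(* The plane contains [delta]. *)
have evE z : ev p z = ip p.1 z.1 by rewrite /aff_dot p2 mul0r addr0.
have p1 : p.1 != 0 by apply: contra p0 => /eqP p1; case: (p) p1 p2 => u c /= -> ->.
have [xP _] := aff_pos_root Xx.
have [a [pa a0]] : exists a, pos_root Phi Pi a /\ ip p.1 a = 0.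
  rewrite evE in px; case: (root_pos_or_neg xP) => ?; first by exists x.1.
  by exists (- x.1); rewrite dotNr px oppr0.
have [aP _] := pa.
(* These are the simple roots of the affine system of rank one cut out by the plane; by reducedness
   its roots lie over [a] and [- a] only. *)
exists (a, 0), (- a, 1); split.
- by apply/aff_posP; split=> //=; right.
- by apply/aff_posP; split=> /=; [exact: rootN|exact: rpred1|left].
- by apply/eqP => -[_] /eqP; rewrite eq_sym oner_eq0.
- by rewrite !evE /= dotNr a0 oppr0.
move=> [b c] Xz; rewrite evE /= => bp; have [/= bP ci c0] := (aff_posP _).1 Xz.
have [u [t e]] := orth_decomp b p1 (root_neq0 aP) a0.
have u0 : u = 0.
  move: bp; rewrite e !dotE a0 mulr0 addr0 => /eqP.
  by rewrite mulf_eq0 dot_eq0 (negPf p1) orbF => /eqP.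
rewrite u0 scale0r add0r in e.
have : t *: a \in Phi by rewrite -e.
move=> /(rs_reduced rootPhi aP)[t1|t1].
  have c0' : 0 <= c by case: c0 => [/ltW|[-> _]].
  exists (1 + c), c; split=> //; first by rewrite addr_ge0.
  congr pair; first by rewrite e t1 /= scalerDl scalerN addrK.
  by rewrite -[RHS]/((1 + c) * 0 + c * 1) mulr0 add0r mulr1.
have c1 : 1 <= c.
  case: c0 => [c0|[_ pb]].
    have := norm_intr_ge1 ci (lt0r_neq0 c0); by rewrite gtr0_norm.
  by case: (pos_rootN pa); rewrite -scaleN1r -t1 -e.
exists (c - 1), c; split; [by rewrite subr_ge0|exact: le_trans ler01 c1|].
congr pair; first by rewrite e t1 /= scalerBl scale1r scalerN scaleN1r addrAC subrr sub0r.
by rewrite -[RHS]/((c - 1) * 0 + c * 1) mulr0 add0r mulr1.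
Qed.

Local Notation s_ rho := (aff_refl ip rho).

Lemma aff_ip_root_gt0 x : X x -> 0 < aff_ip ip x x.
Proof. by move=> /aff_pos_root[xP _]; exact: root_dot_gt0. Qed.

Lemma aff_reflN x : X x -> s_ x x = - x.
Proof.
move=> /aff_ip_root_gt0 xx; rewrite /aff_refl mulfK ?gt_eqF//.
by rewrite scaler_nat mulr2n opprD addrA subrr sub0r.
Qed.

Lemma aff_ipZl a u v : aff_ip ip (a *: u) v = a * aff_ip ip u v.
Proof. exact: dotZl. Qed.

Lemma aff_ipBl u v w : aff_ip ip (u - v) w = aff_ip ip u w - aff_ip ip v w.
Proof. exact: dotBl. Qed.

Lemma aff_ipC u v : aff_ip ip u v = aff_ip ip v u.
Proof. exact: dotC. Qed.

Lemma aff_reflB x u v : s_ x (u - v) = s_ x u - s_ x v.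
Proof.
rewrite /aff_refl aff_ipBl mulrBr mulrBl scalerBl !opprB.
by rewrite addrACA [RHS]addrACA (addrC (- v)).
Qed.

Lemma aff_reflZ x c u : s_ x (c *: u) = c *: s_ x u.
Proof.
rewrite /aff_refl aff_ipZl scalerBr scalerA; congr (_ - _ *: _).
by rewrite mulrCA -!mulrA.
Qed.

Lemma aff_reflK x : X x -> involutive (s_ x).
Proof.
move=> Xx u; rewrite [X in s_ x X]/aff_refl aff_reflB aff_reflZ aff_reflN//.
by rewrite scalerN opprK /aff_refl subrK.
Qed.

Lemma aff_ip_refl x u v : X x -> aff_ip ip (s_ x u) (s_ x v) = aff_ip ip u v.
Proof.
move=> /aff_ip_root_gt0 xx; rewrite /aff_refl !aff_ipBl !aff_ipZl.
rewrite !(aff_ipC _ (v - _)) !aff_ipBl !aff_ipZl (aff_ipC x u) (aff_ipC v u).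
by field; rewrite gt_eqF.
Qed.

Lemma aff_refl_conj x z : X x -> s_ z = s_ x \o s_ (s_ x z) \o s_ x.
Proof.
move=> Xx; apply/funext => v /=.
suff -> : s_ (s_ x z) (s_ x v) = s_ x (s_ z v) by rewrite aff_reflK.
rewrite -[LHS]/(s_ x v - (2 * aff_ip ip (s_ x v) (s_ x z) /
  aff_ip ip (s_ x z) (s_ x z)) *: s_ x z).
by rewrite !aff_ip_refl// -aff_reflZ -aff_reflB.
Qed.

Lemma generated_group (T : Type) (S : set (T -> T)) :
  transformation_group (generated_by S).
Proof.
split.
- by move=> W [[]].
- by move=> f g Wf Wg W [gW SW]; have [_ + _] := gW; apply; [apply: Wf|apply: Wg].
- move=> f g Wf fg gf W [gW SW]; have [_ _ +] := gW => /(_ f); apply=> //.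
  exact: Wf.
Qed.

Lemma generated_sub (T : Type) (S W : set (T -> T)) :
  transformation_group W -> S `<=` W -> generated_by S `<=` W.
Proof. by move=> gW SW f; apply. Qed.

Lemma sub_generated (T : Type) (S : set (T -> T)) : S `<=` generated_by S.
Proof. by move=> f Sf W [_]; apply. Qed.

Lemma aff_dotNr q a : ev q (- a) = - ev q a.
Proof. exact: dotNr. Qed.

Lemma aff_dot_comb q a b (c d : R) : ev q a = 0 -> ev q b = 0 ->
  ev q (c *: a + d *: b) = 0.
Proof.
move=> qa qb; rewrite dotDr !dotZr -[X in _ * X + _]/(ev q a) qa.
by rewrite -[X in _ + _ * X]/(ev q b) qb !mulr0 addr0.
Qed.

Lemma aff_dot_refl q a v : ev q a = 0 -> ev q (s_ a v) = ev q v.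
Proof.
move=> qa; rewrite /aff_refl dotBr dotZr -[X in _ * X]/(ev q a) qa.
by rewrite mulr0 subr0.
Qed.

(* Reflections in vectors of the plane [q = 0] preserve [q]. *)
Lemma generated_plane q a b z : ev q a = 0 -> ev q b = 0 -> X z ->
  generated_by [set s_ a; s_ b] (s_ z) -> ev q z = 0.
Proof.
move=> qa qb Xz Wz.
have : [set w : M -> M | forall v, ev q (w v) = ev q v] (s_ z).
  apply: (generated_sub _ _ Wz) => [|_ [->|->] v]; last 2 first.
  - exact: aff_dot_refl.
  - exact: aff_dot_refl.
  split=> //= [f g hf hg v|f g hf fg gf v]; first by rewrite /= hf hg.
  by rewrite -hf gf.
by move=> /(_ z); rewrite aff_reflN// aff_dotNr; lra.
Qed.

Lemma generated_cone (W : set (M -> M)) p a b : p != 0 -> X a -> X b -> a != b ->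
  ev p a = 0 -> ev p b = 0 ->
  (forall z, X z -> ev p z = 0 ->
     exists c d, [/\ 0 <= c, 0 <= d & z = c *: a + d *: b]) ->
  transformation_group W -> W (s_ a) -> W (s_ b) ->
  forall z, X z -> ev p z = 0 -> W (s_ z).
Proof.
move=> p0 Xa Xb ab pa pb cone [_ Wcomp _] Wa Wb.
have [f f2 fX] := exists_positive.
have indep (c d : R) : c *: a + d *: b = 0 -> c = 0 /\ d = 0.
  have := free_roots fX X_red Xa Xb ab.
  rewrite free_cons span_seq1 seq1_free => /andP[nab b0] e.
  have c0 : c = 0.
    apply/eqP; apply: contraT => c0; case/negP: nab.
    apply/vlineP; exists (- (c^-1 * d)).
    rewrite scaleNr; apply/eqP; rewrite -addr_eq0.
    rewrite -(inj_eq (scalerI c0)) scaler0 scalerDr scalerA mulVKf//.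
    by rewrite e.
  split=> //; move: e; rewrite c0 scale0r add0r => /eqP.
  by rewrite scaler_eq0 (negPf b0) orbF => /eqP.
(* Reflecting in [a] or [b] decreases [c + d] by at least 1. *)
suff main n z c d : X z -> ev p z = 0 -> 0 <= c -> 0 <= d ->
    z = c *: a + d *: b -> c + d < n%:R -> W (s_ z).
  move=> z Xz pz; have [c [d [c0 d0 e]]] := cone z Xz pz.
  apply: (main (Num.bound (c + d)) z c d) => //.
  by apply: archi_boundP; rewrite addr_ge0.
elim: n z c d => [|n IHn] z c d Xz pz c0 d0 ez cdn; first by lra.
have [c00|cn0] := eqVneq c 0.
  rewrite c00 scale0r add0r in ez.
  by rewrite (aff_pos_scale Xb Xz ez).
have [d00|dn0] := eqVneq d 0.
  rewrite d00 scale0r addr0 in ez.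
  by rewrite (aff_pos_scale Xa Xz ez).
have cp : 0 < c by rewrite lt0r cn0.
have dp : 0 < d by rewrite lt0r dn0.
have [zP zi] := aff_pos_root Xz.
have step u v (k l : R) : X u -> W (s_ u) -> ev p u = 0 -> 0 < k -> 0 < l ->
    z = k *: u + l *: v -> (u = a /\ v = b \/ u = b /\ v = a) ->
    0 < ip z.1 u.1 -> k + l < n.+1%:R -> W (s_ z).
  move=> Xu Wu pu k0 l0 e uv zu kln; have [uP ui] := aff_pos_root Xu.
  set m := pairing z.1 u.1.
  have m0 : 0 < m by rewrite /m /pairing divr_gt0 ?root_dot_gt0// mulr_gt0.
  have mi : m \is a Num.int by exact: pairing_int.
  have m1 : 1 <= m by have := norm_intr_ge1 mi (lt0r_neq0 m0); rewrite gtr0_norm.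
  have sz : s_ u z = (k - m) *: u + l *: v.
    by rewrite /aff_refl -/m {1}e scalerBl addrAC.
  have szr : aff_root (s_ u z).
    by split; [exact: pairing_root|rewrite /= rpredB// rpredM].
  have psz : ev p (s_ u z) = 0 by rewrite aff_dot_refl.
  have comb w : X w -> ev p w = 0 -> exists k' l',
      [/\ 0 <= k', 0 <= l' & w = k' *: u + l' *: v].
    move=> Xw pw; have [c' [d' [c0' d0' ->]]] := cone w Xw pw.
    by case: uv => -[-> ->]; [exists c', d'|exists d', c'; rewrite addrC].
  have indep' k' l' : k' *: u + l' *: v = 0 -> k' = 0 /\ l' = 0.
    case: uv => -[-> ->]; first exact: indep.
    by rewrite addrC => /indep[].
  (* The image cannot be negative: its coefficient at [v] is still the positive number [l]. *)
  case: (aff_root_pos_or_neg szr) => Xs; last first.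
    have [|k' [l' [k0' l0']]] := comb _ Xs; first by rewrite aff_dotNr psz oppr0.
    move=> /eqP; rewrite -subr_eq0 -opprD oppr_eq0 sz addrACA -!scalerDl.
    by move=> /eqP /indep'[_]; lra.
  have [k' [l' [k0' l0' e']]] := comb _ Xs psz.
  have [ek el] : k' - (k - m) = 0 /\ l' - l = 0.
    by apply: indep'; rewrite (scalerBl k') (scalerBl l') addrACA -opprD -sz -e' subrr.
  rewrite (aff_refl_conj z Xu); apply: (Wcomp _ _ _ Wu); apply: (Wcomp _ _ Wu).
  case: uv => -[eu ev']; subst u v.
    apply: (IHn _ k' l') => //; move: kln; rewrite -natr1; lra.
  apply: (IHn _ l' k') => //; first by rewrite addrC.
  by move: kln; rewrite -natr1; lra.
(* As [z] has positive norm, its product with [a] or with [b] is positive, and the reflection in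
   that root lowers the coefficient sum. *)
have zz : 0 < c * ip z.1 a.1 + d * ip z.1 b.1.
  have := root_dot_gt0 zP; rewrite {2}ez /= dotDr.
  by rewrite !dotZr.
have [za|za] := ltP 0 (ip z.1 a.1).
  by apply: (step a b c d) => //; left.
have zb : 0 < ip z.1 b.1.
  rewrite ltNge; apply/negP => zb.
  have h1 : c * ip z.1 a.1 <= 0 by rewrite pmulr_rle0.
  have h2 : d * ip z.1 b.1 <= 0 by rewrite pmulr_rle0.
  by lra.
apply: (step b a d c) => //; [by rewrite addrC|by right|by rewrite addrC].
Qed.

(** The generating roots of a dihedral subgroup containing [W] span a plane [q = 0] that also
    contains the independent roots [a] and [b]. It is therefore the plane [p = 0], and the
    generators already lie in [W]. *)
Lemma plane_maximal_dihedral p x y : p != 0 -> X x -> X y -> x != y ->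
  ev p x = 0 -> ev p y = 0 -> exists2 W, maximal_dihedral ip Phi Pi W &
  forall z, subgroup_roots ip Phi Pi W z <-> X z /\ ev p z = 0.
Proof.
move=> p0 Xx Xy xy px py.
have [a [b [Xa Xb ab [pa pb] cone]]] := plane_roots p0 Xx Xy xy px py.
pose W := generated_by [set s_ a; s_ b].
have Wa : W (s_ a) by apply: sub_generated; left.
have Wb : W (s_ b) by apply: sub_generated; right.
have gen : forall z, X z -> ev p z = 0 -> W (s_ z).
  exact: (generated_cone p0 Xa Xb ab pa pb cone (generated_group _)).
have neq u v : X u -> X v -> u != v -> s_ u <> s_ v.
  move=> Xu Xv uv e; case/eqP: uv.
  apply: (aff_pos_scale Xv Xu (c := aff_ip ip u v / aff_ip ip v v)).
  have := congr1 (fun w => w u) e; rewrite aff_reflN// /aff_refl => eu.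
  apply: (@scalerI _ _ 2); first by rewrite pnatr_eq0.
  rewrite scalerA mulrA scaler_nat mulr2n.
  by rewrite -[X in _ + X = _]opprK eu opprB addrC subrK.
have [f f2 fX] := exists_positive.
exists W; last first.
  move=> z; split=> [[Xz Wz]|[Xz pz]]; last by split=> //; exact: gen.
  by split=> //; exact: generated_plane Wz.
split; first by exists a, b; split=> //; exact: neq.
move=> W' [r1 [r2 [Xr1 Xr2 r12 ->]]] [WW']; apply.
have [q q0 [qr1 qr2]] := exists_orth ev dim_affine r1 r2.
have qa : ev q a = 0 by apply: (generated_plane qr1 qr2) => //; exact: WW'.
have qb : ev q b = 0 by apply: (generated_plane qr1 qr2) => //; exact: WW'.
have fab := free_roots fX X_red Xa Xb ab.
have pr r : ev q r = 0 -> ev p r = 0.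
  move=> qr; have [c [d ->]] := orth_span dim_affine q0 fab qa qb qr.
  exact: aff_dot_comb.
apply: generated_sub; first exact: generated_group.
by move=> _ [->|->]; apply: gen => //; exact: pr.
Qed.

End Roots.

(** * From reversals along planes to braid edges *)

Lemma reflection_orderP (R : realType) (V : vectType R) (Phi Pi : seq V)
    (O : affine_space V R -> affine_space V R -> Prop) :
  reflection_order Phi Pi O <-> total_interval_order (aff_pos Phi Pi) O.
Proof.
split=> o; split=> //.
- by move=> x Xx _; exact: (ro_irr o).
- by move=> x y z Xx _ Xy _ Xz _; exact: (ro_trans o).
- by move=> x y Xx _ Xy _; exact: (ro_total o).
- by move=> x y a b Xx _ Xy _ xy a0 b0 Xz _; exact: (ro_convex o).
- by move=> x Xx; exact: (io_irr o).
- by move=> x y z Xx Xy Xz; exact: (io_trans o Xx id Xy id Xz id).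
- by move=> x y Xx Xy; exact: (io_total o Xx id Xy id).
- by move=> x y a b Xx Xy xy a0 b0 Xz; exact: (io_in o Xx id Xy id xy a0 b0 Xz id).
Qed.

Theorem theorem6p6 (R : realType) (V : vectType R) (ip : {dot V for idfun})
    (Phi Pi : seq V) (rootPhi : root_system ip Phi)
    (irrPhi : irreducible_roots ip Phi) (dimV : \dim {: V} = 2%N)
    (simplePi : simple_system Phi Pi)
    (E : set (affine_space V R)) (finE : finite_set E)
    (subE : E `<=` aff_pos Phi Pi) :
  braid_graph_connected ip Phi Pi E.
Proof.
have [e0 eE0] := (finite_seqP E).1 finE.
pose e := undup e0.
have ue : uniq e by exact: undup_uniq.
have eE x : (x \in e) <-> E x by rewrite mem_undup eE0.
have eX x : x \in e -> aff_pos Phi Pi x by move=> /eE/subE.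
have [f f2 fX] := exists_positive rootPhi simplePi dimV.
have dim3 := dim_affine dimV.
have red (x y : affine_space V R) (c : R) (Xx : aff_pos Phi Pi x)
  (Xy : aff_pos Phi Pi y) (xy : y = c *: x) := aff_pos_scale rootPhi simplePi Xx Xy xy.
have [T0 oT0] := exists_total_order dim3 fX red.
have setP s : perm_eq s e -> [set` s] = E.
  move=> se; apply/seteqP; split=> x /=; first by rewrite (perm_mem se) => /eE.
  by move=> /eE; rewrite -(perm_mem se).
have vertexP s : vertex (aff_pos Phi Pi) e s <-> braid_vertex Phi Pi E s.
  split=> [[O oO [se ps]]|[us sE [O oO sO]]].
    split; [by rewrite (perm_uniq se)|exact: setP|].
    exists O; first exact/reflection_orderP.
    move=> i j /andP[ij js]; apply/asboolP.
    by move/(pairwiseP 0): ps => ps; apply: ps; rewrite ?inE// (ltn_trans ij js).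
  exists O; first exact/reflection_orderP; split.
    apply: uniq_perm => // x; apply/idP/idP => [xs|/eE].
      by apply/eE; rewrite -sE.
    by rewrite -sE.
  apply/(pairwiseP 0) => i j _ js ij; apply/asboolP/sO.
  by rewrite ij.
have sep s : braid_vertex Phi Pi E s -> separated (aff_dot ip) (aff_pos Phi Pi) s.
  move=> [us sE [O oO sO]]; apply: (order_separated rootPhi simplePi irrPhi dimV oO) => //.
  by move=> x xs; apply: subE; rewrite -sE.
split.
  have [s es] := enumerates_exists ue eX (total_order_extendable e oT0).
  by exists s; apply/vertexP; exists T0.
move=> s1 s2 v1 v2.
have := connected_all dim3 fX red ue eX oT0 ((vertexP s1).2 v1) ((vertexP s2).2 v2)
  (sep _ v1) (sep _ v2).
elim=> [s s'|s|s t s' _ st _ ts]; [|exact: rt_refl|exact: rt_trans st ts].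
move=> [vs vs' [u [t [v [p [es es' p0 tp st]]]]]]; apply: rt_step.
split; [exact/vertexP|exact/vertexP|exists u, t, v; split=> //].
have us : uniq t.
  have [/= us _ _] := (vertexP s).1 vs.
  by move: us; rewrite es !cat_uniq => /and3P[_ _ /and3P[]].
(* A flip reverses at least two roots, so its plane contains two distinct ones and carries a maximal
   dihedral subgroup. *)
have [x [y [xt yt xy]]] : exists x y, [/\ x \in t, y \in t & x != y].
  case: t us st {es es' tp} => [|x [|y t]] //= /andP[xyt _] _.
  exists x, y; rewrite !inE !eqxx orbT; split=> //.
  by move: xyt; rewrite inE negb_or => /andP[].
have tE z : z \in t -> z \in e /\ aff_dot ip p z = 0.
  by rewrite tp => /andP[ze /eqP].
have [[xe px] [ye py]] := (tE _ xt, tE _ yt).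
have [W maxW WP] := plane_maximal_dihedral rootPhi simplePi dimV p0
  (eX _ xe) (eX _ ye) xy px py.
exists W => //; apply/seteqP; split=> z /=.
  by move=> [/eE ze /WP[_ pz]]; rewrite tp ze; apply/eqP.
by move=> /tE[ze pz]; split; [exact/eE|apply/WP; split=> //; exact: eX].
Qed.
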